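(* Let $\mathcal{C}$ and $\overline{\mathcal{C}}$ be two algebraic plane curves having the same asymptotic behavior. Then the Hausdorff distance between them is finite.
   Context: An algebraic plane curve $\mathcal{C}$ is the set of complex zeros in $\mathbb{C}^2$ of an irreducible polynomial $f(x,y)\in\mathbb{R}[x,y]$. Let $F(x,y,z)\in\mathbb{R}[x,y,z]$ be the homogenization of $f$ and $\mathcal{C}^*\subset\mathbb{P}^2(\mathbb{C})$ the corresponding projective curve; an infinity point of $\mathcal{C}$ is a point of $\mathcal{C}^*$ with $z=0$. Standing assumption: for every curve considered, $(0:1:0)$ is not an infinity point, i.e. all infinity points have the form $(1:m:0)$ with $m\in\mathbb{C}$. Infinity branches. Let $P=(1:m:0)$ be an infinity point of $\mathcal{C}$ and let $g(y,z)=F(1,y,z)$. Let $\varphi(z)=m+a_1z^{N_1/N}+a_2z^{N_2/N}+\cdots$ (a finite or infinite sum, $a_i\neq 0$, $N,N_i\in\mathbb{N}$, $0<N_1<N_2<\cdots$) be a Puiseux series with $g(\varphi(z),z)=0$, where $N$ is the ramification index of $\varphi$ (the least common denominator of its exponents). Put $r(z)=z\varphi(z^{-1})=mz+a_1z^{1-N_1/N}+a_2z^{1-N_2/N}+\cdots$. Its conjugates are $r_j(z)=mz+a_1c_j^{N_1}z^{1-N_1/N}+a_2c_j^{N_2}z^{1-N_2/N}+\cdots$, $j=1,\dots,N$, where $c_1,\dots,c_N$ are the $N$ complex roots of $x^N=1$. Let $M\in\mathbb{R}^+$ be such that these series converge for $|z|>M$; then $f(z,r_j(z))=0$ for $|z|>M$.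 The set $B=\bigcup_{j=1}^N L_j$ with $L_j=\{(z,r_j(z))\in\mathbb{C}^2: z\in\mathbb{C},\ |z|>M\}$ is an infinity branch of $\mathcal{C}$ associated to $P$, and the $L_j$ are its leaves. Convention: fractional powers are evaluated with one fixed determination, $z^{1/N}=\exp(\mathrm{Log}(z)/N)$ with $\mathrm{Log}$ the principal logarithm, and $z^{1-k/N}=z\,(z^{1/N})^{-k}$. Two leaves $L=\{(z,r(z)): |z|>M\}$ and $\overline{L}=\{(z,\overline{r}(z)): |z|>\overline{M}\}$ are convergent if $\lim_{z\to\infty}(\overline{r}(z)-r(z))=0$, where $z\to\infty$ in $\mathbb{C}$ means $|z|\to\infty$. Two infinity branches $B$ and $\overline{B}$ are convergent if there exist two convergent leaves $L\subset B$ and $\overline{L}\subset\overline{B}$. Two curves $\mathcal{C}$ and $\overline{\mathcal{C}}$ have the same asymptotic behavior if every infinity branch of $\mathcal{C}$ is convergent with some infinity branch of $\overline{\mathcal{C}}$, and reciprocally every infinity branch of $\overline{\mathcal{C}}$ is convergent with some infinity branch of $\mathcal{C}$. With $d$ the Euclidean distance on $\mathbb{C}^2$ and $d(p,\mathcal{C})=\min\{d(p,q): q\in\mathcal{C}\}$, the Hausdorff distance between the curves (as subsets of $\mathbb{C}^2$) is $d_H(\mathcal{C},\overline{\mathcal{C}})=\max\{\sup_{p\in\mathcal{C}}d(p,\overline{\mathcal{C}}),\ \sup_{\overline{p}\in\overline{\mathcal{C}}}d(\overline{p},\mathcal{C})\}$. *)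

(* Defs.v *)
From HB Require Import structures.
From mathcomp Require Import all_boot all_order all_algebra.
From mathcomp Require Import polyXY.
From mathcomp Require Import all_classical all_reals all_analysis.
From mathcomp Require Import complex.

Set Implicit Arguments.
Unset Strict Implicit.
Unset Printing Implicit Defensive.

Import Order.TTheory GRing.Theory Num.Theory.
Import numFieldNormedType.Exports.

Local Open Scope classical_set_scope.
Local Open Scope complex_scope.
Local Open Scope ring_scope.

(* The complex field is R[i]; its topology is that of the normed space R[i]^o,
   and the real-valued modulus is normc. *)
Notation normc := ComplexField.Normc.normc.

(* Bivariate polynomials follow polyXY: the outer variable is x, the inner one
   is y, so f`_i`_j is the coefficient of x^i y^j and f.[x, y] the value. *)

Definition irreducible2 (R : realType) (f : {poly {poly R}}) : Prop :=
  [/\ f != 0, f \isn't a GRing.unit &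
      forall p q : {poly {poly R}}, f = p * q ->
        p \is a GRing.unit \/ q \is a GRing.unit].

Definition curve (R : realType) (f : {poly {poly R}}) : set (R[i] * R[i]) :=
  [set p | (map_poly (map_poly (real_complex R)) f).[p.1, p.2] = 0].

Definition tdegree (R : realType) (f : {poly {poly R}}) : nat :=
  \max_(i < size f | f`_i != 0) (i + (size (f`_i)%R).-1)%N.

(* From the outermost to the innermost, the variables are x, y, z. *)
Definition homogenization (R : realType) (f : {poly {poly R}}) :
    {poly {poly {poly R}}} :=
  \sum_(i < size f) \sum_(j < size f`_i)
    ((f`_i`_j *: 'X^(tdegree f - i - j)) *: 'X^j) *: 'X^i.

Definition eval3 (R A : comNzRingType) (phi : R -> A)
    (F : {poly {poly {poly R}}}) (x y z : A) : A :=
  (map_poly (map_poly (map_poly phi)) F).[x%:P%:P].[y%:P].[z].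

(* (x : y : 0) is an infinity point of the curve; only used for
   (x, y) <> (0, 0). *)
Definition infinity_point (R : realType) (f : {poly {poly R}}) (x y : R[i]) :
    Prop :=
  eval3 (real_complex R) (homogenization f) x y 0 = 0.

(* The principal argument, in ]-pi, pi] for z != 0. *)
Definition carg (R : realType) (z : R[i]) : R :=
  if 0 <= complex.Im z then acos (complex.Re z / normc z)
  else - acos (complex.Re z / normc z).

Definition clog (R : realType) (z : R[i]) : R[i] := ln (normc z) +i* carg z.

Definition cexp (R : realType) (z : R[i]) : R[i] :=
  (expR (complex.Re z))%:C *
    (cos (complex.Im z) +i* sin (complex.Im z)).

Definition nth_root (R : realType) (N : nat) (z : R[i]) : R[i] :=
  cexp (clog z / N%:R).

(* A Puiseux series sum_k a_k z^(k/N) is given by N and the sequence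
   a : nat -> R[i] of all its coefficients, zero ones included. *)

(* N is the least common denominator of the exponents k / N with a_k != 0:
   D is a common denominator iff N divides D * k for all such k. *)
Definition ramification_index (R : realType) (N : nat) (a : nat -> R[i]) :
    Prop :=
  (0 < N)%N /\
  forall D : nat, (0 < D)%N ->
    (forall k, a k != 0 -> (N %| D * k)%N) -> (N <= D)%N.

(* g(phi(z), z) = F(1, phi(z), z) = 0 as a formal identity. With z = t^N it
   reads F(1, sum_k a_k t^k, t^N) = 0 in C[[t]], that is, modulo t^n for
   every n. *)
Definition puiseux_solution (R : realType) (f : {poly {poly R}}) (N : nat)
    (a : nat -> R[i]) : Prop :=
  forall n : nat,
    'X^n %| eval3 (polyC \o real_complex R) (homogenization f)
              1 (\poly_(k < n) a k) ('X^N).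

(* The terms a_k c^k z^(1 - k/N) of the conjugate series r_j, with c = c_j. *)
Definition conj_term (R : realType) (N : nat) (a : nat -> R[i]) (c z : R[i])
    (k : nat) : R[i]^o :=
  a k * c ^+ k * (z * nth_root N z ^- k).

Record infinity_branch (R : realType) (f : {poly {poly R}}) := InfinityBranch {
  branch_index : nat;
  branch_coef : nat -> R[i];
  branch_radius : R;
  branch_point : infinity_point f 1 (branch_coef 0%N);
  branch_ramification : ramification_index branch_index branch_coef;
  branch_solution : puiseux_solution f branch_index branch_coef;
  branch_radius_gt0 : 0 < branch_radius;
  branch_cvg : forall c z : R[i], c ^+ branch_index = 1 ->
    branch_radius < normc z ->
    cvgn (series (conj_term branch_index branch_coef c z))
}.

(* The leaf {(z, r z) : |z| > M}, kept as the pair (M, r). *)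
Record leaf (R : realType) := Leaf {
  leaf_radius : R;
  leaf_fun : R[i] -> R[i]
}.

Definition leaf_set (R : realType) (L : leaf R) : set (R[i] * R[i]) :=
  [set p | leaf_radius L < normc p.1 /\ p.2 = leaf_fun L p.1].

Definition branch_leaf (R : realType) (f : {poly {poly R}})
    (B : infinity_branch f) (c : R[i]) : leaf R :=
  Leaf (branch_radius B)
    (fun z => limn (series (conj_term (branch_index B) (branch_coef B) c z))).

(* The leaves L_1, ..., L_N, indexed by the N complex roots c of x^N = 1. *)
Definition leaves (R : realType) (f : {poly {poly R}})
    (B : infinity_branch f) : set (leaf R) :=
  [set branch_leaf B c | c in [set c : R[i] | c ^+ branch_index B = 1]].

Definition branch_set (R : realType) (f : {poly {poly R}})
    (B : infinity_branch f) : set (R[i] * R[i]) :=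
  \bigcup_(L in leaves B) leaf_set L.

(* The filter of z --> oo in the complex plane, i.e., |z| --> +oo. *)
Definition cinfty_nbhs (R : realType) : set_system R[i] :=
  filter_from [set: R] (fun K => [set z : R[i] | K < normc z]).

Definition convergent_leaves (R : realType) (L L' : leaf R) : Prop :=
  (fun z => leaf_fun L' z - leaf_fun L z : R[i]^o) @ @cinfty_nbhs R -->
    (0 : R[i]^o).

Definition convergent_branches (R : realType) (f g : {poly {poly R}})
    (B : infinity_branch f) (B' : infinity_branch g) : Prop :=
  exists L L' : leaf R,
    [/\ leaves B L, leaves B' L' & convergent_leaves L L'].

Definition same_asymptotic_behavior (R : realType) (f g : {poly {poly R}}) :
    Prop :=
  (forall B : infinity_branch f,
     exists B' : infinity_branch g, convergent_branches B B') /\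
  (forall B' : infinity_branch g,
     exists B : infinity_branch f, convergent_branches B' B).

Definition edist2 (R : realType) (p q : R[i] * R[i]) : R :=
  Num.sqrt (normc (p.1 - q.1) ^+ 2 + normc (p.2 - q.2) ^+ 2).

(* For a nonempty closed set, such as a curve, the infimum is a minimum. *)
Definition dist_set (R : realType) (p : R[i] * R[i]) (A : set (R[i] * R[i])) :
    \bar R :=
  ereal_inf [set (edist2 p q)%:E | q in A].

Definition hausdorff_dist (R : realType) (A B : set (R[i] * R[i])) : \bar R :=
  Order.max (ereal_sup [set dist_set p B | p in A])
            (ereal_sup [set dist_set q A | q in B]).

(* Main.v *)
From HB Require Import structures.
Require Import Defs.
From mathcomp Require Import all_boot all_order all_algebra.
From mathcomp Require Import all_classical all_reals all_analysis.
From mathcomp Require Import complex.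
From mathcomp Require Import zify ring lra.

Set Implicit Arguments.
Unset Strict Implicit.
Unset Printing Implicit Defensive.

Import Order.TTheory GRing.Theory Num.Theory.
Import numFieldNormedType.Exports.

Local Open Scope classical_set_scope.
Local Open Scope complex_scope.
Local Open Scope ring_scope.

(** Why two curves with the same asymptotic behavior stay at bounded distance.

  As (0:1:0) is not at infinity, the coefficient of [y^d] in [f], with [d] the
  total degree, is a nonzero constant.  Over a bounded set of [x] the points
  of the curve are thus bounded ([near_points_bounded]), and only the points
  with [x] large matter.

  Put [t = x^(-1/N)].  By Puiseux's theorem [F(1, y, t^N)] splits, for some
  [N], into factors [y - phi_j(t)] where the [phi_j] are convergent power
  series ([puiseux]).  Hence every point over a large [x] is
  [(x, x phi_j(t))] for some [j].  After division of [N] and of the exponents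
  by their common divisor, [phi_j] defines an infinity branch of the curve
  ([branch_of_root]), so the hypothesis supplies a branch of the other curve
  convergent with it.

  The two convergent leaves need not be those evaluated at [t].  With [N],
  [N'] the two indices, [M = N N'] and [s = x^(-1/M)], both leaves are [s^(-M)]
  times a power series in [s].  Their difference tends to [0], which forces
  the two series to agree below degree [M] ([fps_vanish_of_small]).  This is an
  identity of coefficients, so it survives the rotation of [s] by a root of
  unity, which turns the given leaf of the first branch into the one needed.
  The difference of the rotated leaves is [s^(-M) O(s^M)], a bounded quantity
  ([branch_close]); the rotated leaf of the second branch lies on the second
  curve ([leaf_on_curve]).

  Puiseux's theorem is proved by the Newton polygon.  If [P(0, y)] has a zero
  of order [m] at [0], the derivative of order [m - 1] in [y] has a simple
  zero there, which the implicit function theorem ([implicit_root]) extends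
  to a power series [h].  In [y - h] the term of degree [m - 1] is absent, so
  that the first edge of the Newton polygon gives a polynomial all of whose
  roots have multiplicity less than [m] ([low_multiplicity]); the induction
  is on [m] ([newton_root]).  Convergence costs nothing along the way, since
  the convergent series form a ring ([fps_cvg]) and the implicit function
  theorem stays in it: its Picard iterates are bounded in a majorant norm
  ([picard_limit_cvg]). *)

(** * Formal power series *)

(** A series is its sequence of coefficients, as for Puiseux solutions; the
  name keeps the Cauchy product apart from the pointwise one. *)
Definition fps (K : comNzRingType) : Type := nat -> K.

HB.instance Definition _ (K : comNzRingType) := Choice.on (fps K).
HB.instance Definition _ (K : comNzRingType) :=
  GRing.Zmodule.copy (fps K) (nat -> K).

Section FpsRing.
Variable K : comNzRingType.
Implicit Types (a b c : fps K) (p q : {poly K}) (n k N : nat).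

Definition fps_trunc n a : {poly K} := \poly_(i < n) a i.

Definition fps_of_poly p : fps K := fun k => p`_k.

Definition fps_mul a b : fps K :=
  fun n => \sum_(i < n.+1) a i * b (n - i)%N.

(** A coefficient of a product depends on finitely many coefficients of the
  factors, so that the ring identities are inherited from polynomials. *)
Lemma fps_mul_coef a b p q k :
    (forall i, (i <= k)%N -> a i = p`_i) ->
    (forall i, (i <= k)%N -> b i = q`_i) ->
  fps_mul a b k = (p * q)`_k.
Proof.
move=> ap bq; rewrite coefM; apply: eq_bigr => -[i /= lik] _.
by rewrite ap// bq// leq_subr.
Qed.

Lemma coef_fps_trunc n a i : (i < n)%N -> a i = (fps_trunc n a)`_i.
Proof. by rewrite coef_poly => ->. Qed.

Lemma fps_mulE n a b i : (i < n)%N ->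
  fps_mul a b i = (fps_trunc n a * fps_trunc n b)`_i.
Proof.
move=> lin; apply: fps_mul_coef => j lji;
by rewrite -coef_fps_trunc// (leq_ltn_trans lji lin).
Qed.

Lemma fps_mulA : associative fps_mul.
Proof.
move=> a b c; apply/funext => k.
set A := fps_trunc k.+1 a; set B := fps_trunc k.+1 b.
set D := fps_trunc k.+1 c.
rewrite (@fps_mul_coef _ _ A (B * D)) ?(@fps_mul_coef _ _ (A * B) D) ?mulrA//;
  by move=> i ik; rewrite -1?coef_fps_trunc// -1?fps_mulE.
Qed.

Lemma fps_mulC : commutative fps_mul.
Proof. by move=> a b; apply/funext => k; rewrite !(@fps_mulE k.+1)// mulrC. Qed.

Lemma fps_mul1 : left_id (fps_of_poly 1) fps_mul.
Proof.
move=> a; apply/funext => k.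
rewrite (@fps_mul_coef _ _ 1 (fps_trunc k.+1 a))// ?mul1r -?coef_fps_trunc//.
by move=> i ik; rewrite -coef_fps_trunc.
Qed.

Lemma fps_mulDl : left_distributive fps_mul +%R.
Proof.
move=> a b c; apply/funext => k; rewrite /fps_mul [RHS]/GRing.add/=.
by rewrite -big_split; apply: eq_bigr => i _; exact: mulrDl.
Qed.

Lemma fps_1neq0 : fps_of_poly 1 != 0.
Proof.
apply/eqP => /(congr1 (fun a : fps K => a 0%N)).
by rewrite /fps_of_poly coef1/=; apply/eqP/oner_neq0.
Qed.

HB.instance Definition _ := GRing.Zmodule_isComNzRing.Build (fps K)
  fps_mulA fps_mulC fps_mul1 fps_mulDl fps_1neq0.

Lemma fpsD a b k : (a + b) k = a k + b k. Proof. by []. Qed.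
Lemma fpsN a k : (- a) k = - a k. Proof. by []. Qed.
Lemma fps0 k : (0 : fps K) k = 0. Proof. by []. Qed.
Lemma fpsM a b k : (a * b) k = \sum_(i < k.+1) a i * b (k - i)%N.
Proof. by []. Qed.
Lemma fps1 k : (1 : fps K) k = (k == 0%N)%:R. Proof. by rewrite -coef1. Qed.

Lemma fpsM_coef n a b i : (i < n)%N ->
  (a * b) i = (fps_trunc n a * fps_trunc n b)`_i.
Proof. exact: fps_mulE. Qed.

Lemma fps_of_poly_is_zmod_morphism : zmod_morphism fps_of_poly.
Proof. by move=> p q; apply/funext => k; rewrite /fps_of_poly coefB. Qed.

Lemma fps_of_poly_is_monoid_morphism : monoid_morphism fps_of_poly.
Proof.
split=> // p q; apply/funext => k.
by rewrite /fps_of_poly coefM fpsM.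
Qed.

HB.instance Definition _ :=
  GRing.isZmodMorphism.Build _ _ fps_of_poly fps_of_poly_is_zmod_morphism.
HB.instance Definition _ :=
  GRing.isMonoidMorphism.Build _ _ fps_of_poly fps_of_poly_is_monoid_morphism.

Definition fpsC (c : K) : fps K := fps_of_poly c%:P.

Lemma fpsC_is_zmod_morphism : zmod_morphism fpsC.
Proof. by move=> x y; rewrite /fpsC rmorphB rmorphB. Qed.
Lemma fpsC_is_monoid_morphism : monoid_morphism fpsC.
Proof. by split=> [|x y]; rewrite /fpsC ?rmorph1// !rmorphM. Qed.
HB.instance Definition _ :=
  GRing.isZmodMorphism.Build _ _ fpsC fpsC_is_zmod_morphism.
HB.instance Definition _ :=
  GRing.isMonoidMorphism.Build _ _ fpsC fpsC_is_monoid_morphism.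

Lemma coef_fpsC (c : K) k : fpsC c k = if k == 0%N then c else 0.
Proof. by rewrite /fpsC /fps_of_poly coefC. Qed.

Lemma fpsCM (c : K) a k : (fpsC c * a) k = c * a k.
Proof.
rewrite fpsM big_ord_recl/= subn0 big1 ?addr0 ?coef_fpsC//.
by move=> i _; rewrite coef_fpsC/= mul0r.
Qed.

Definition fps_at0 a : K := a 0%N.
Lemma fps_at0_is_zmod_morphism : zmod_morphism fps_at0. Proof. by []. Qed.
Lemma fps_at0_is_monoid_morphism : monoid_morphism fps_at0.
Proof.
by split=> [|a b]; rewrite /fps_at0 ?fps1// fpsM big_ord1.
Qed.
HB.instance Definition _ :=
  GRing.isZmodMorphism.Build _ _ fps_at0 fps_at0_is_zmod_morphism.
HB.instance Definition _ :=
  GRing.isMonoidMorphism.Build _ _ fps_at0 fps_at0_is_monoid_morphism.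

(** The series [a(t^N)]. *)
Definition fps_subst N a : fps K :=
  fun k => if (N %| k)%N then a (k %/ N)%N else 0.

Lemma fps_subst_is_zmod_morphism N : zmod_morphism (fps_subst N).
Proof.
move=> a b; apply/funext => k; rewrite fpsD fpsN /fps_subst.
by case: ifP; rewrite ?subrr.
Qed.

(** At [N = 0] the map sends a series to its constant coefficient, which is
  why multiplicativity holds there too. *)
Lemma fps_subst_is_monoid_morphism N : monoid_morphism (fps_subst N).
Proof.
split=> [|a b].
  apply/funext => k; rewrite /fps_subst !fps1; case: ifPn => [/dvdnP[q ->]|].
    by case: N => [|N]; rewrite ?muln0 ?mulnK// muln_eq0 orbF.
  by case: k => //; rewrite dvdn0.
case: N => [|N]; apply/funext => k.
  rewrite fpsM /fps_subst dvd0n divn0; case: eqP => [->|/eqP k0].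
    by rewrite fpsM !big_ord1/= !divn0.
  rewrite big1// => i _; rewrite !dvd0n.
  case: ifP => [/eqP ->|]; last by rewrite mul0r.
  by rewrite subn0 (negPf k0) mulr0.
set A := fps_trunc k.+1 a \Po 'X^(N.+1).
set B := fps_trunc k.+1 b \Po 'X^(N.+1).
have E (c : fps K) i : (i <= k)%N ->
    fps_subst N.+1 c i = (fps_trunc k.+1 c \Po 'X^(N.+1))`_i.
  move=> ik; rewrite coef_comp_poly_Xn// /fps_subst; case: ifP => // _.
  by rewrite -coef_fps_trunc// ltnS (leq_trans (leq_div _ _)).
rewrite [RHS](@fps_mul_coef _ _ A B); [|exact: E|exact: E].
rewrite /A/B -comp_polyM coef_comp_poly_Xn// /fps_subst; case: ifP => // _.
by rewrite -fpsM_coef// ltnS leq_div.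
Qed.

HB.instance Definition _ N :=
  GRing.isZmodMorphism.Build _ _ (fps_subst N) (fps_subst_is_zmod_morphism N).
HB.instance Definition _ N :=
  GRing.isMonoidMorphism.Build _ _ (fps_subst N)
    (fps_subst_is_monoid_morphism N).

Lemma fps_subst_poly N p : (0 < N)%N ->
  fps_subst N (fps_of_poly p) = fps_of_poly (p \Po 'X^N).
Proof.
by move=> N0; apply/funext => k; rewrite /fps_of_poly coef_comp_poly_Xn.
Qed.

Lemma fps_substC N (c : K) : fps_subst N (fpsC c) = fpsC c.
Proof.
apply/funext => k; rewrite /fps_subst !coef_fpsC.
case: ifPn => [/dvdnP[q ->]|].
  by case: N => [|N]; rewrite ?muln0 ?mulnK// muln_eq0 orbF.
by case: k => //; rewrite dvdn0.
Qed.

Lemma fps_subst_subst M N a : (0 < M)%N -> (0 < N)%N ->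
  fps_subst M (fps_subst N a) = fps_subst (M * N) a.
Proof.
move=> M0 N0; apply/funext => k; rewrite /fps_subst.
case: ifPn => [/dvdnP[q ->]|].
  rewrite mulnK// [(q * M)%N]mulnC dvdn_pmul2l//; case: ifP => // _.
  by rewrite divnMl.
by case: ifPn => // /(dvdn_trans (dvdn_mulr _ (dvdnn M))) ->.
Qed.

Lemma fps_subst_inj N : (0 < N)%N -> injective (fps_subst N).
Proof.
move=> N0 a b ab; apply/funext => k.
have := congr1 (fun c : fps K => c (N * k)%N) ab.
by rewrite /fps_subst dvdn_mulr// mulKn.
Qed.

(** [fps_vanish n a] says that [a] has order at least [n] in [t]; working with
  this rather than with a valuation avoids a value for the zero series. *)
Definition fps_vanish n a := forall k, (k < n)%N -> a k = 0.

Lemma fps_vanish0 n : fps_vanish n 0. Proof. by []. Qed.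
Lemma fps_vanishD n a b :
  fps_vanish n a -> fps_vanish n b -> fps_vanish n (a + b).
Proof. by move=> va vb k kn; rewrite fpsD va// vb// addr0. Qed.
Lemma fps_vanishN n a : fps_vanish n a -> fps_vanish n (- a).
Proof. by move=> va k kn; rewrite fpsN va// oppr0. Qed.
Lemma fps_vanishM m n a b :
  fps_vanish m a -> fps_vanish n b -> fps_vanish (m + n) (a * b).
Proof.
move=> va vb k kmn; rewrite fpsM big1// => i _.
have [im|mi] := ltnP i m; first by rewrite va// mul0r.
by rewrite vb ?mulr0//; have := ltn_ord i; lia.
Qed.
Lemma fps_vanishMl n a b : fps_vanish n b -> fps_vanish n (a * b).
Proof. by move=> vb; rewrite -[n]add0n; apply: fps_vanishM. Qed.
Lemma fps_vanish_le m n a : (m <= n)%N -> fps_vanish n a -> fps_vanish m a.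
Proof. by move=> mn va k km; rewrite va// (leq_trans km). Qed.
Lemma fps_vanish_sum n I (r : seq I) (P : pred I) (F : I -> fps K) :
  (forall i, P i -> fps_vanish n (F i)) -> fps_vanish n (\sum_(i <- r | P i) F i).
Proof.
move=> vF; elim/big_ind: _ => //; exact: fps_vanishD.
Qed.
Lemma fps_vanish_eq0 a : (forall n, fps_vanish n a) -> a = 0.
Proof. by move=> va; apply/funext => k; rewrite (va k.+1). Qed.
Lemma fps_vanish_trunc n a : fps_vanish n (a - fps_of_poly (fps_trunc n a)).
Proof.
by move=> k kn; rewrite fpsD fpsN /fps_of_poly -coef_fps_trunc// subrr.
Qed.
Definition fpsXn n : fps K := fps_of_poly 'X^n.

Lemma coef_fpsXn n k : fpsXn n k = (k == n)%:R.
Proof. by rewrite /fpsXn /fps_of_poly coefXn. Qed.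

Lemma fpsXnD m n : fpsXn (m + n) = fpsXn m * fpsXn n.
Proof. by rewrite /fpsXn exprD rmorphM. Qed.

Lemma fpsXnX m n : fpsXn m ^+ n = fpsXn (m * n).
Proof. by rewrite /fpsXn -rmorphXn exprM. Qed.

Lemma fps_substXn N n : (0 < N)%N -> fps_subst N (fpsXn n) = fpsXn (N * n).
Proof.
by move=> N0; rewrite /fpsXn fps_subst_poly// rmorphXn /= comp_polyX -exprM.
Qed.

(** The quotient by [t^n] of a series of order at least [n]. *)
Definition fps_shift n a : fps K := fun k => a (n + k)%N.

Lemma coef_fpsXnM n a k :
  (fpsXn n * a) k = if (k < n)%N then 0 else a (k - n)%N.
Proof.
rewrite [LHS](@fps_mul_coef _ _ 'X^n (fps_trunc k.+1 a)) ?coefXnM//; last first.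
  by move=> i ik; rewrite -coef_fps_trunc.
by case: ltnP => // nk; rewrite -coef_fps_trunc// ltnS leq_subr.
Qed.

Lemma fps_shiftK n a : fps_vanish n a -> fpsXn n * fps_shift n a = a.
Proof.
move=> va; apply/funext => k; rewrite coef_fpsXnM.
by case: ltnP => [/va->//|nk]; rewrite /fps_shift subnKC.
Qed.

Lemma fps_subst_vanish N n a : (0 < N)%N ->
  fps_vanish n a -> fps_vanish (N * n) (fps_subst N a).
Proof.
move=> N0 va k; rewrite /fps_subst; case: ifP => // /dvdnP[q ->].
by rewrite mulnC ltn_pmul2l// mulKn//; apply: va.
Qed.

End FpsRing.

(** * The modulus of a complex number *)

Section Modulus.
Variable R : realType.
Implicit Types (x y z : R[i]).

Lemma norm_normc z : `|z| = (normc z)%:C. Proof. by []. Qed.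

Lemma normc_ge0 z : 0 <= normc z. Proof. by case: z => a b; exact: sqrtr_ge0. Qed.

Lemma normcX z n : normc (z ^+ n) = normc z ^+ n.
Proof.
elim: n => [|n IH]; first by rewrite !expr0 ComplexField.Normc.normc1.
by rewrite !exprS ComplexField.Normc.normcM IH.
Qed.

Lemma normc_eq0 z : (normc z == 0) = (z == 0).
Proof.
apply/eqP/eqP => [/ComplexField.Normc.eq0_normc//|->].
exact: ComplexField.Normc.normc0.
Qed.

Lemma normc_gt0 z : (0 < normc z) = (z != 0).
Proof. by rewrite lt_def normc_eq0 normc_ge0 andbT. Qed.

Lemma normcD x y : normc (x + y) <= normc x + normc y.
Proof. exact: le_normcD. Qed.

Lemma normcB x y : normc (x - y) = normc (y - x).
Proof. by rewrite -(normcN (x - y)) opprB. Qed.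

Lemma normc_sum I (r : seq I) (P : pred I) (F : I -> R[i]) :
  normc (\sum_(i <- r | P i) F i) <= \sum_(i <- r | P i) normc (F i).
Proof.
elim/big_rec2: _ => [|i y1 y2 _ le12]; first by rewrite ComplexField.Normc.normc0.
by rewrite (le_trans (normcD _ _))// lerD2l.
Qed.

Lemma normc_real (r : R) : normc r%:C = `|r|.
Proof. by rewrite /= expr0n/= addr0 sqrtr_sqr. Qed.

Lemma normc_Re_le z : `|complex.Re z| <= normc z.
Proof. by rewrite -lecR; exact: normc_ge_Re. Qed.

Lemma normc_Im_le z : `|complex.Im z| <= normc z.
Proof.
case: z => a b /=; rewrite -(sqrtr_sqr b) ler_sqrt ?lerDr ?sqr_ge0//.
by rewrite addr_ge0 ?sqr_ge0.
Qed.

Lemma normc_le_ReIm z : normc z <= `|complex.Re z| + `|complex.Im z|.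
Proof.
case: z => a b /=; rewrite -[leRHS]ger0_norm ?addr_ge0// -sqrtr_sqr.
rewrite ler_sqrt ?sqr_ge0// sqrrD !real_normK ?num_real//.
by rewrite lerD2r lerDl mulrn_wge0// mulr_ge0.
Qed.

(** The norm of [R[i]] takes complex values; this is the statement with the
  real modulus. *)
Lemma cvgcP (u : nat -> R[i]^o) (l : R[i]^o) :
  u @ \oo --> l <->
  forall e : R, 0 < e -> exists N, forall n, (N <= n)%N -> normc (l - u n) < e.
Proof.
split=> [/cvgrPdist_lt cu e e0|cu].
  have /cu : 0 < e%:C :> R[i] by rewrite ltcR.
  by case=> N _ uN; exists N => n /uN; rewrite /= norm_normc ltcR.
apply/cvgrPdist_lt => e; rewrite ltcE => /andP[/eqP /= e0 /cu[N uN]].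
exists N => // n /= /uN le; rewrite norm_normc (_ : e = (complex.Re e)%:C).
  by rewrite ltcR.
by case: e e0 {le uN} => a b /= ->.
Qed.

Lemma cvgc_normc_le (u : nat -> R[i]^o) (l : R[i]^o) (B : R) :
  (forall n, normc (u n) <= B) -> u @ \oo --> l -> normc l <= B.
Proof.
move=> uB /cvgcP ul; apply/ler_addgt0Pr => e e0.
have [N /(_ N (leqnn _)) lN] := ul e e0.
rewrite -(subrK (u N) l) (le_trans (normcD _ _))// addrC lerD//.
exact: ltW.
Qed.

Lemma cvgc0_le (u : nat -> R[i]^o) (B q : R) : 0 <= q < 1 ->
  (forall n, normc (u n) <= B * q ^+ n) -> u @ \oo --> (0 : R[i]^o).
Proof.
move=> /andP[q0 q1] uB; apply/cvgcP => e e0.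
have /cvgrPdist_lt/(_ e e0)[N _ HN] : B * q ^+ n @[n --> \oo] --> (0 : R).
  rewrite -(mulr0 B); apply: cvgMl_tmp; apply: cvg_expr.
  by rewrite ger0_norm.
exists N => n /HN /=; rewrite !sub0r normrN normcN; apply: le_lt_trans.
exact: le_trans (uB n) (ler_norm _).
Qed.

Lemma cvgcD (u v : nat -> R[i]^o) (a b : R[i]^o) :
  u @ \oo --> a -> v @ \oo --> b ->
  (fun n => u n + v n : R[i]^o) @ \oo --> (a + b : R[i]^o).
Proof. by move=> ua vb; exact: (cvgD ua vb). Qed.

Lemma cvgcN (u : nat -> R[i]^o) (a : R[i]^o) :
  u @ \oo --> a -> (fun n => - u n : R[i]^o) @ \oo --> (- a : R[i]^o).
Proof. by move=> ua; exact: (cvgN ua). Qed.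

Lemma cvgcM (u v : nat -> R[i]^o) (a b : R[i]^o) :
  u @ \oo --> a -> v @ \oo --> b ->
  (fun n => u n * v n : R[i]^o) @ \oo --> (a * b : R[i]^o).
Proof. by move=> ua vb; exact: (cvgM ua vb). Qed.

Lemma cvgc_cst (c : R[i]^o) : (fun _ : nat => c) @ \oo --> c.
Proof. exact: cvg_cst. Qed.

Lemma cvgc_ext (u v : nat -> R[i]^o) (l : R[i]^o) :
  u @ \oo --> l -> u =1 v -> v @ \oo --> l.
Proof. by move=> ul /funext <-. Qed.

(** The supremum of the [x n - e n] stays within [e n] of each [x n]; this
  gives the limit together with the rate, without the Cauchy filter. *)
Lemma real_limit_rate (x e : nat -> R) :
    (forall n m, (n <= m)%N -> `|x m - x n| <= e n) ->
  exists a, forall n, `|a - x n| <= e n.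
Proof.
move=> xe.
have e0 n : 0 <= e n by apply: le_trans (xe n n _).
have le n m : x n - e n <= x m + e m.
  have [/xe|/ltnW/xe] := leqP n m; rewrite ler_norml => /andP[].
    by have := e0 m; lra.
  by have := e0 n; lra.
pose A : set R := [set x n - e n | n in [set: nat]].
have A0 : A !=set0 by exists (x 0%N - e 0%N); exists 0%N.
have bA m : ubound A (x m + e m) by move=> _ [n _ <-].
have hA : has_sup A by split=> //; exists (x 0%N + e 0%N).
exists (sup A) => n; rewrite ler_norml; apply/andP; split.
  have : x n - e n <= sup A by apply: sup_upper_bound => //; exists n.
  lra.
by have : sup A <= x n + e n by [exact: ge_sup|]; lra.
Qed.

Lemma complex_limit_rate (u : nat -> R[i]) (e : nat -> R) :
    (forall n m, (n <= m)%N -> normc (u m - u n) <= e n) ->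
  exists l, forall n, normc (l - u n) <= e n + e n.
Proof.
move=> ue.
have Reue n m : (n <= m)%N -> `|complex.Re (u m) - complex.Re (u n)| <= e n.
  move=> /ue; apply: le_trans; rewrite (le_trans _ (normc_Re_le _))//.
  by case: (u m) (u n) => [? ?] [].
have Imue n m : (n <= m)%N -> `|complex.Im (u m) - complex.Im (u n)| <= e n.
  move=> /ue; apply: le_trans; rewrite (le_trans _ (normc_Im_le _))//.
  by case: (u m) (u n) => [? ?] [].
have [a Ha] := real_limit_rate Reue; have [b Hb] := real_limit_rate Imue.
exists (a +i* b) => n; rewrite (le_trans (normc_le_ReIm _))//.
by have := lerD (Ha n) (Hb n); case: (u n).
Qed.

End Modulus.

(** * Convergent power series *)

Section Bound.
Variable R : realType.
Implicit Types (a b : fps R[i]) (r M : R).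

(** The majorant norm at radius [r] is at most [M].  It is submultiplicative,
  and bounding all partial sums avoids infinite ones. *)
Definition fps_bound r M a :=
  forall n, \sum_(k < n) normc (a k) * r ^+ k <= M.

Lemma fps_bound_ge0 r M a : fps_bound r M a -> 0 <= M.
Proof. by move/(_ 0%N); rewrite big_ord0. Qed.

Lemma fps_bound_le r M r' M' a : 0 <= r' <= r -> M <= M' ->
  fps_bound r M a -> fps_bound r' M' a.
Proof.
move=> /andP[r0 rr] MM aM n; rewrite (le_trans _ MM)// (le_trans _ (aM n))//.
apply: ler_sum => k _; rewrite ler_wpM2l ?normc_ge0// lerXn2r// nnegrE//.
exact: le_trans rr.
Qed.

Lemma fps_boundD r M L a b : 0 <= r -> fps_bound r M a -> fps_bound r L b ->
  fps_bound r (M + L) (a + b).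
Proof.
move=> r0 aM bL n; rewrite (le_trans _ (lerD (aM n) (bL n)))// -big_split/=.
by apply: ler_sum => k _; rewrite -mulrDl ler_wpM2r ?exprn_ge0// normcD.
Qed.

Lemma fps_boundN r M a : fps_bound r M a -> fps_bound r M (- a).
Proof.
move=> aM n; rewrite (le_trans _ (aM n))//; apply: ler_sum => k _.
by rewrite fpsN normcN.
Qed.

Lemma fps_boundM r M L a b : 0 <= r -> fps_bound r M a -> fps_bound r L b ->
  fps_bound r (M * L) (a * b).
Proof.
move=> r0 aM bL n.
pose A := \poly_(i < n) (normc (a i) * r ^+ i).
pose B := \poly_(i < n) (normc (b i) * r ^+ i).
have A0 k : 0 <= A`_k.
  by rewrite coef_poly; case: ifP => // _; rewrite mulr_ge0 ?normc_ge0 ?exprn_ge0.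
have B0 k : 0 <= B`_k.
  by rewrite coef_poly; case: ifP => // _; rewrite mulr_ge0 ?normc_ge0 ?exprn_ge0.
have hornerT n' (F : nat -> R) : (\poly_(i < n') F i).[1] = \sum_(i < n') F i.
  by rewrite horner_poly; apply: eq_bigr => i _; rewrite expr1n mulr1.
have AM : A.[1] <= M by rewrite hornerT.
have BL : B.[1] <= L by rewrite hornerT.
have AB : (A * B).[1] <= M * L.
  rewrite hornerM ler_pM// horner_coef sumr_ge0// => i _;
  by rewrite expr1n mulr1.
apply: le_trans AB.
have le : \sum_(k < n) normc ((a * b) k) * r ^+ k <= \sum_(k < n) (A * B)`_k.
  apply: ler_sum => k _; rewrite coefM.
  rewrite (le_trans (ler_wpM2r _ (normc_sum _ _ _))) ?exprn_ge0//.
  rewrite mulr_suml; apply: ler_sum => i _.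
  rewrite !coef_poly (leq_ltn_trans _ (ltn_ord k)); last by rewrite -ltnS.
  rewrite (leq_ltn_trans _ (ltn_ord k)) ?leq_subr//.
  rewrite ComplexField.Normc.normcM mulrACA -exprD subnKC//.
  by rewrite -ltnS.
apply: (le_trans le).
rewrite (horner_coef_wide _ (leq_addr n (size (A * B)))) addnC big_split_ord/=.
under [X in _ <= X + _]eq_bigr do rewrite expr1n mulr1.
rewrite lerDl sumr_ge0// => i _; rewrite expr1n mulr1 coefM sumr_ge0// => j _.
exact: mulr_ge0.
Qed.

Lemma fps_boundX r M a n : 0 <= r -> fps_bound r M a ->
  fps_bound r (M ^+ n) (a ^+ n).
Proof.
move=> r0 aM; elim: n => [|n IH]; last by rewrite !exprS; exact: fps_boundM.
move=> [|n]; rewrite ?big_ord0 ?expr0// big_ord_recl/= big1 ?addr0.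
  by rewrite fps1 mulr1n ComplexField.Normc.normc1 mulr1.
by move=> i _; rewrite fps1 mulr0n ComplexField.Normc.normc0 mul0r.
Qed.

Lemma fps_bound_poly r (p : {poly R[i]}) : 0 <= r ->
  fps_bound r (\sum_(k < size p) normc p`_k * r ^+ k) (fps_of_poly p).
Proof.
move=> r0 n; have [np|/ltnW pn] := leqP n (size p).
  rewrite -(subnKC np) big_split_ord/= lerDl sumr_ge0// => k _.
  by rewrite mulr_ge0 ?normc_ge0 ?exprn_ge0.
rewrite -(subnKC pn) big_split_ord/= gerDl.
rewrite le_eqVlt; apply/orP; left; apply/eqP; apply: big1 => k _.
by rewrite /fps_of_poly nth_default ?leq_addr// ComplexField.Normc.normc0 mul0r.
Qed.

(** Scaling the radius by [q <= 1] gains a factor [q] per order of vanishing. *)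
Lemma fps_bound_vanish r M q n a : 0 <= r -> 0 <= q <= 1 ->
  fps_vanish n a -> fps_bound r M a -> fps_bound (r * q) (M * q ^+ n) a.
Proof.
move=> r0 /andP[q0 q1] va aM m.
have M0 := fps_bound_ge0 aM.
apply: (@le_trans _ _ (\sum_(k < m) normc (a k) * r ^+ k * q ^+ n)).
  apply: ler_sum => k _; have [kn|nk] := ltnP k n.
    by rewrite va// ComplexField.Normc.normc0 !mul0r.
  rewrite exprMn mulrA ler_wpM2l ?mulr_ge0 ?normc_ge0 ?exprn_ge0//.
  by rewrite ler_wiXn2l.
by rewrite -mulr_suml ler_wpM2r ?exprn_ge0.
Qed.

(** Halving the radius turns bounded terms into a summable series. *)
Lemma fps_bound_of_terms r M a : 0 <= r ->
  (forall k, normc (a k) * r ^+ k <= M) -> fps_bound (r / 2) (2 * M) a.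
Proof.
move=> r0 aM n.
have M0 : 0 <= M by apply: le_trans (aM 0%N); rewrite mulr_ge0 ?normc_ge0.
apply: (@le_trans _ _ (\sum_(k < n) M * (2^-1) ^+ k)).
  by apply: ler_sum => k _; rewrite exprMn mulrA ler_wpM2r ?exprn_ge0.
rewrite -mulr_sumr mulrC ler_wpM2r//.
have -> : \sum_(k < n) (2^-1 : R) ^+ k = 2 - 2 * 2^-1 ^+ n.
  elim: n => [|n IH]; first by rewrite big_ord0 expr0 mulr1 subrr.
  by rewrite big_ord_recr/= IH exprS; field.
have : 0 <= (2^-1 : R) ^+ n by rewrite exprn_ge0.
lra.
Qed.

End Bound.

(** * Values of convergent power series *)

Section Value.
Variable R : realType.
Implicit Types (a b : fps R[i]) (r M : R) (t v w : R[i]).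

(** Convergence in a disc containing [t] in its interior: a subring for each
  [t], and at [t = 0] the ring of convergent power series. *)
Definition fps_cvg t : {pred fps R[i]} :=
  fun a => `[< exists r M, normc t < r /\ fps_bound r M a >].

Lemma fps_cvgP t a :
  reflect (exists r M, normc t < r /\ fps_bound r M a) (a \in fps_cvg t).
Proof. exact: asboolP. Qed.

Lemma fps_cvg2 t a b : a \in fps_cvg t -> b \in fps_cvg t ->
  exists r M L, [/\ normc t < r, fps_bound r M a & fps_bound r L b].
Proof.
move=> /fps_cvgP[r [M [tr aM]]] /fps_cvgP[s [L [ts bL]]].
have lt0 x : normc t < x -> 0 <= x.
  by move=> tx; rewrite ltW// (le_lt_trans _ tx)// normc_ge0.
exists (Num.min r s), M, L; split; first by rewrite lt_min tr ts.
  by apply: fps_bound_le aM; rewrite // le_min !lt0//= ge_min lexx.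
by apply: fps_bound_le bL; rewrite // le_min !lt0//= ge_min lexx orbT.
Qed.

Lemma fps_of_poly_cvg t p : fps_of_poly p \in fps_cvg t.
Proof.
apply/fps_cvgP; exists (normc t + 1); eexists.
split; first by rewrite ltrDl.
by apply: fps_bound_poly; rewrite addr_ge0 ?normc_ge0.
Qed.

Lemma fps_cvg_subring t : subring_closed (fps_cvg t).
Proof.
split=> [|a b ta tb|a b ta tb]; first exact: (fps_of_poly_cvg _ 1).
  have [r [M [L [tr aM bL]]]] := fps_cvg2 ta tb.
  have r0 : 0 <= r by rewrite ltW// (le_lt_trans _ tr)// normc_ge0.
  apply/fps_cvgP; exists r, (M + L); split=> //.
  by apply: fps_boundD => //; apply: fps_boundN.
have [r [M [L [tr aM bL]]]] := fps_cvg2 ta tb.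
have r0 : 0 <= r by rewrite ltW// (le_lt_trans _ tr)// normc_ge0.
by apply/fps_cvgP; exists r, (M * L); split=> //; apply: fps_boundM.
Qed.

HB.instance Definition _ t :=
  GRing.isSubringClosed.Build (fps R[i]) (fps_cvg t) (fps_cvg_subring t).

(** A relation rather than a function: convergence is carried along with the
  value. *)
Definition fps_value t a v : Prop :=
  a \in fps_cvg t /\
  ((fun n => (fps_trunc n a).[t] : R[i]^o) @ \oo --> (v : R[i]^o)).

Lemma fps_value_uniq t a v w : fps_value t a v -> fps_value t a w -> v = w.
Proof.
move=> [_ av] [_ aw].
exact: (cvg_unique (@norm_hausdorff _ (R[i]^o)) av aw).
Qed.

(** The ratio [|t| / r < 1] is gained once for each vanishing coefficient;
  this is the source of all the error estimates. *)
Lemma horner_trunc_le r M n a t m : 0 < r -> normc t <= r ->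
    fps_vanish n a -> fps_bound r M a ->
  normc (fps_trunc m a).[t] <= M * (normc t / r) ^+ n.
Proof.
move=> r0 tr va aM.
have q01 : 0 <= normc t / r <= 1.
  by rewrite divr_ge0 ?normc_ge0 ?(ltW r0)//= ler_pdivrMr// mul1r.
apply: le_trans (fps_bound_vanish (ltW r0) q01 va aM m).
rewrite horner_poly (le_trans (normc_sum _ _ _))//.
apply: ler_sum => k _.
by rewrite mulrCA divff ?gt_eqF// mulr1 ComplexField.Normc.normcM normcX.
Qed.

Lemma fps_value_le r M n a t v : 0 < r -> normc t <= r ->
    fps_vanish n a -> fps_bound r M a -> fps_value t a v ->
  normc v <= M * (normc t / r) ^+ n.
Proof.
move=> r0 tr va aM [_]; apply: cvgc_normc_le => m.
exact: horner_trunc_le.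
Qed.

Lemma fps_trunc_vanish m n a : (n <= m)%N ->
  fps_vanish n (fps_of_poly (fps_trunc m a - fps_trunc n a)).
Proof.
move=> nm k kn; rewrite /fps_of_poly coefB -!coef_fps_trunc ?subrr//.
exact: leq_trans nm.
Qed.

Lemma fps_of_polyK m (p : {poly R[i]}) : (size p <= m)%N -> fps_trunc m (fps_of_poly p) = p.
Proof.
move=> pm; apply/polyP => k; rewrite coef_poly; case: ltnP => // mk.
by rewrite nth_default// (leq_trans pm).
Qed.

Lemma fps_bound_trunc r M n a : 0 <= r ->
  fps_bound r M a -> fps_bound r M (fps_of_poly (fps_trunc n a)).
Proof.
move=> r0 aM m; rewrite (le_trans _ (aM m))//; apply: ler_sum => k _.
rewrite ler_wpM2r ?exprn_ge0// /fps_of_poly coef_poly.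
by case: ifP => // _; rewrite ComplexField.Normc.normc0 normc_ge0.
Qed.

(** Two partial sums differ by a polynomial of high order, so they form a
  geometric Cauchy sequence. *)
Lemma fps_value_ex t a : a \in fps_cvg t -> exists v, fps_value t a v.
Proof.
move=> ta; have /fps_cvgP[r [M [tr aM]]] := ta.
have r0 : 0 < r by rewrite (le_lt_trans _ tr)// normc_ge0.
pose q := normc t / r.
have q01 : 0 <= q < 1.
  by rewrite divr_ge0 ?normc_ge0 ?(ltW r0)//= ltr_pdivrMr// mul1r.
have [v Hv] : exists v, forall n, normc (v - (fps_trunc n a).[t])
    <= (M + M) * q ^+ n + (M + M) * q ^+ n.
  apply: (@complex_limit_rate _ _ (fun n => (M + M) * q ^+ n)) => n m nm.
  rewrite -hornerN -hornerD; set p := fps_trunc m a - _.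
  rewrite -(fps_of_polyK (leqnn (size p))).
  apply: horner_trunc_le; rewrite ?ltW//; first exact: fps_trunc_vanish.
  rewrite /p rmorphB; apply: (fps_boundD (ltW r0)); last apply: fps_boundN;
    by apply: fps_bound_trunc => //; rewrite ltW.
exists v; split=> //; rewrite -[v]subr0.
have v0 : (fun n => v - (fps_trunc n a).[t] : R[i]^o) @ \oo --> (0 : R[i]^o).
  by apply: (@cvgc0_le _ _ (M + M + (M + M)) q) => // n; rewrite mulrDl Hv.
apply: (cvgc_ext (cvgcD (@cvgc_cst _ v) (cvgcN v0))) => n.
exact: subKr.
Qed.

Lemma fps_valueD t a b v w :
  fps_value t a v -> fps_value t b w -> fps_value t (a + b) (v + w).
Proof.
move=> [ta av] [tb bw]; split; first exact: rpredD.
apply: (cvgc_ext (cvgcD av bw)) => n; rewrite -hornerD; congr _.[t]; apply/polyP => k.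
by rewrite coefD !coef_poly; case: ifP; rewrite ?addr0.
Qed.

Lemma fps_valueN t a v : fps_value t a v -> fps_value t (- a) (- v).
Proof.
move=> [ta av]; split; first by rewrite rpredN.
apply: (cvgc_ext (cvgcN av)) => n; rewrite -hornerN; congr _.[t]; apply/polyP => k.
by rewrite coefN !coef_poly; case: ifP; rewrite ?oppr0.
Qed.

Lemma fps_valueB t a b v w :
  fps_value t a v -> fps_value t b w -> fps_value t (a - b) (v - w).
Proof. by move=> av /fps_valueN; apply: fps_valueD. Qed.

Lemma fps_value_poly t p : fps_value t (fps_of_poly p) p.[t].
Proof.
split; first exact: fps_of_poly_cvg.
apply/cvgcP => e e0; exists (size p) => n pn.
by rewrite fps_of_polyK// subrr ComplexField.Normc.normc0.
Qed.

(** Truncation commutes with products up to terms of order [n], and those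
  are worth a geometric error. *)
Lemma fps_valueM t a b v w :
  fps_value t a v -> fps_value t b w -> fps_value t (a * b) (v * w).
Proof.
move=> [ta av] [tb bw]; split; first exact: rpredM.
have [r [M [L [tr aM bL]]]] := fps_cvg2 ta tb.
have r0 : 0 < r by rewrite (le_lt_trans _ tr)// normc_ge0.
have r0' := ltW r0.
pose q := normc t / r.
have q01 : 0 <= q < 1.
  by rewrite divr_ge0 ?normc_ge0 ?(ltW r0)//= ltr_pdivrMr// mul1r.
pose p n := fps_trunc n a * fps_trunc n b - fps_trunc n (a * b).
have p0 : (fun n => (p n).[t] : R[i]^o) @ \oo --> (0 : R[i]^o).
  apply: (@cvgc0_le _ _ (M * L + M * L) q) => // n.
  rewrite -(fps_of_polyK (leqnn (size (p n)))).
  apply: horner_trunc_le; rewrite ?ltW//.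
    move=> k kn; rewrite /fps_of_poly coefB -fpsM_coef//.
    by rewrite -coef_fps_trunc// subrr.
  rewrite /p rmorphB rmorphM; apply: (fps_boundD r0').
    by apply: (fps_boundM r0'); apply: fps_bound_trunc.
  by apply: fps_boundN; apply: fps_bound_trunc => //; apply: fps_boundM.
rewrite -[v * w]subr0.
apply: (cvgc_ext (cvgcD (cvgcM av bw) (cvgcN p0))) => n.
by rewrite /p hornerD hornerN hornerM subKr.
Qed.

Lemma fps_valueX t a v n : fps_value t a v -> fps_value t (a ^+ n) (v ^+ n).
Proof.
move=> av; elim: n => [|n IH]; last by rewrite !exprS; apply: fps_valueM.
by rewrite !expr0 -[1 in X in fps_value _ _ X](hornerC 1 t); apply: fps_value_poly.
Qed.

Lemma fps_valueC t c : fps_value t (fpsC c) c.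
Proof. by have := fps_value_poly t c%:P; rewrite hornerC. Qed.

Lemma fps_valueXn t n : fps_value t (fpsXn _ n) (t ^+ n).
Proof. by have := fps_value_poly t 'X^n; rewrite hornerXn. Qed.

Lemma fps_value_sum t I (s : seq I) (a : I -> fps R[i]) (v : I -> R[i]) :
    (forall i, fps_value t (a i) (v i)) ->
  fps_value t (\sum_(i <- s) a i) (\sum_(i <- s) v i).
Proof.
move=> av; elim/big_rec2: _ => [|i x y _]; last exact: fps_valueD.
by have := fps_valueC t 0; rewrite rmorph0.
Qed.

(** For a radius of convergence of [a(t^N)] from one of [a(t)]. *)
Lemma nth_root_between (s r : R) N : (0 < N)%N -> 0 <= s -> s ^+ N < r ->
  exists2 r', s < r' & r' ^+ N = r.
Proof.
move=> N0 s0 sr; have r0 : 0 < r by rewrite (le_lt_trans _ sr)// exprn_ge0.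
have E : (r `^ N%:R^-1) ^+ N = r.
  rewrite -powR_mulrn ?powR_ge0// -powRrM mulVf ?powRr1 ?(ltW r0)//.
  by rewrite pnatr_eq0 -lt0n.
exists (r `^ N%:R^-1) => //.
by rewrite -(ltr_pXn2r N0) ?nnegrE ?powR_ge0// E.
Qed.

(** Only the exponents [N k] contribute to the majorant of [a(t^N)]. *)
Lemma fps_bound_subst r M N a : (0 < N)%N -> 0 <= r ->
  fps_bound (r ^+ N) M a -> fps_bound r M (fps_subst N a).
Proof.
move=> N0 r0 aM n; apply: le_trans (aM n).
pose F k := normc (fps_subst N a k) * r ^+ k.
have F0 k : 0 <= F k by rewrite mulr_ge0 ?normc_ge0 ?exprn_ge0.
rewrite -[leLHS]/(\sum_(k < n) F k).
apply: (@le_trans _ _ (\sum_(k < N * n) F k)).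
  rewrite -(subnKC (leq_pmull n N0)) big_split_ord/= lerDl sumr_ge0//.
rewrite le_eqVlt; apply/orP; left; apply/eqP.
elim: n => [|n IH]; first by rewrite muln0 !big_ord0.
rewrite big_ord_recr/= -IH mulnS addnC big_split_ord/=; congr (_ + _).
rewrite -(prednK N0) big_ord_recl/= (prednK N0) big1 ?addr0 => [|i _].
  by rewrite addn0 /F /fps_subst dvdn_mulr// mulKn// exprM.
rewrite /F /fps_subst dvdn_addr ?dvdn_mulr// gtnNdvd//.
  by rewrite ComplexField.Normc.normc0 mul0r.
by rewrite /bump/= add1n -ltn_predRL.
Qed.

Lemma fps_cvg_subst t N a : (0 < N)%N ->
  a \in fps_cvg (t ^+ N) -> fps_subst N a \in fps_cvg t.
Proof.
move=> N0 /fps_cvgP[r [M [tr aM]]]; move: tr; rewrite normcX.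
move=> /(nth_root_between N0 (normc_ge0 t))[s ts sr].
apply/fps_cvgP; exists s, M; split=> //; apply: fps_bound_subst => //.
  by rewrite (le_trans _ (ltW ts))// normc_ge0.
by rewrite sr.
Qed.

Lemma fps_value_subst t N a v : (0 < N)%N ->
  fps_value (t ^+ N) a v -> fps_value t (fps_subst N a) v.
Proof.
move=> N0 [ta av].
have Sta := fps_cvg_subst N0 ta.
have [w Sw] := fps_value_ex Sta; suff vw : v = w by rewrite vw; exact: Sw.
have [_ /cvgcP Hw] := Sw; apply: (fps_value_uniq (conj ta av)); split; first exact: ta.
apply/cvgcP => e /Hw[n0 Hn0]; exists n0 => n n0n.
have := Hn0 (N * n)%N (leq_trans n0n (leq_pmull _ N0)).
congr (normc (_ - _) < _); rewrite -[X in _ = _.[X]](hornerXn t N) -horner_comp.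
congr _.[t]; apply/polyP => k; rewrite coef_comp_poly_Xn// !coef_poly.
rewrite /fps_subst; case: (boolP (N %| k)%N) => [/dvdnP[q ->]|_].
  by rewrite mulnK// mulnC ltn_pmul2l.
by rewrite if_same.
Qed.

(** The series [a(c t)]. *)
Definition fps_scale (c : R[i]) a : fps R[i] := fun k => c ^+ k * a k.

Lemma fps_bound_scale r M c a : normc c = 1 ->
  fps_bound r M a -> fps_bound r M (fps_scale c a).
Proof.
move=> c1 aM n; rewrite (le_trans _ (aM n))//; apply: ler_sum => k _.
by rewrite ComplexField.Normc.normcM normcX c1 expr1n mul1r.
Qed.

Lemma fps_value_scale t c a v : normc c = 1 ->
  fps_value (c * t) a v -> fps_value t (fps_scale c a) v.
Proof.
move=> c1 [/fps_cvgP[r [M [tr aM]]] av]; split.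
  apply/fps_cvgP; exists r, M; split; last exact: fps_bound_scale.
  by move: tr; rewrite ComplexField.Normc.normcM c1 mul1r.
apply: cvg_trans av; apply: near_eq_cvg; near=> n.
by rewrite !horner_poly; apply: eq_bigr => k _; rewrite exprMn mulrCA mulrA.
Unshelve. all: by end_near. Qed.

(** If the order [k] of the series were less than [m], its value would be
  close to [a_k t^k], which exceeds [t^m] for small [t]. *)
Lemma fps_vanish_of_small r M m a : 0 < r -> fps_bound r M a ->
    (forall e : R, 0 < e -> exists t v,
      [/\ t != 0, normc t < e, fps_value t a v & normc v <= normc t ^+ m]) ->
  fps_vanish m a.
Proof.
move=> r0 aM small k; elim/ltn_ind: k => k IH km.
apply/eqP; rewrite -normc_eq0; apply/negPn/negP => ak0.
have ak : 0 < normc (a k) by rewrite lt_def ak0 normc_ge0.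
pose b := a - fpsC (a k) * fpsXn _ k.
have vb : fps_vanish k.+1 b.
  move=> j; rewrite ltnS /b fpsD fpsN fpsCM coef_fpsXn leq_eqVlt.
  case: eqVneq => [->|_ /= jk]; first by rewrite mulr1 subrr.
  by rewrite mulr0 subr0 IH// (ltn_trans jk).
have [L bL] : exists L, fps_bound r L b.
  eexists; apply: (fps_boundD (ltW r0) aM); apply: fps_boundN.
  by apply: (fps_boundM (ltW r0)); apply: fps_bound_poly; exact: ltW.
have L0 := fps_bound_ge0 bL.
pose D := L / r ^+ k.+1 + 1.
have D0 : 0 < D by rewrite ltr_wpDl// divr_ge0// exprn_ge0// ltW.
have [|t [v [t0 te tv vt]]] := small (Num.min (Num.min r 1) (normc (a k) / D)).
  by rewrite !lt_min r0 ltr01/= divr_gt0.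
move: te; rewrite !lt_min => /andP[/andP[tr t1] te].
have nt0 : 0 < normc t by rewrite normc_gt0.
have tb := fps_valueB tv (fps_valueM (fps_valueC t (a k)) (fps_valueXn t k)).
have le1 := fps_value_le r0 (ltW tr) vb bL tb.
have : normc (a k) * normc t ^+ k <= normc t ^+ k.+1 * D.
  have -> : normc (a k) * normc t ^+ k = normc (v - (v - a k * t ^+ k)).
    by rewrite subKr ComplexField.Normc.normcM normcX.
  rewrite (le_trans (normcD _ _))// normcN [leRHS]mulrC mulrDl mul1r addrC.
  apply: lerD; first by apply: (le_trans le1); rewrite expr_div_n mulrA mulrAC lexx.
  rewrite (le_trans vt)//; apply: ler_wiXn2l => //; exact: ltW.
rewrite exprSr -mulrA mulrC ler_pM2l ?exprn_gt0// leNgt; apply/negP/negPn.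
by rewrite -ltr_pdivlMr.
Qed.

End Value.

(** * Puiseux's theorem *)

Section FormalFixpoint.
Variable K : comNzRingType.
Implicit Types (G P : {poly fps K}) (w : fps K).

Lemma fps_vanish1P w : fps_vanish 1 w <-> fps_at0 w = 0.
Proof. by split=> [H|w0 [|//] _]; [exact: H|exact: w0]. Qed.

Lemma fps_at0_horner P w : fps_at0 w = 0 -> fps_at0 P.[w] = fps_at0 P`_0.
Proof. by move=> w0; rewrite -horner_map/= w0 horner_coef0 coef_map. Qed.

(** [w |-> G(w)] is a contraction of the maximal ideal for the [t]-adic
  distance: [G_1] gains one order, and so does each other monomial. *)
Lemma fps_vanish_horner_sub G n w w' : fps_at0 G`_1 = 0 ->
    fps_vanish 1 w -> fps_vanish 1 w' -> fps_vanish n (w - w') ->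
  fps_vanish n.+1 (G.[w] - G.[w']).
Proof.
move=> /fps_vanish1P G1 w0 w0' ww'.
have vX (x : fps K) k : fps_vanish 1 x -> (0 < k)%N -> fps_vanish 1 (x ^+ k).
  case: k => // k x0 _; rewrite exprSr; exact: fps_vanishMl.
rewrite !horner_coef -sumrB; apply: fps_vanish_sum => -[[|[|i]] /= _] _.
- by rewrite !expr0 subrr; exact: fps_vanish0.
- by rewrite !expr1 -mulrBr -add1n; exact: fps_vanishM.
rewrite -mulrBr; apply: fps_vanishMl; rewrite subrXX -addn1.
apply: fps_vanishM => //; apply: fps_vanish_sum => -[[|j] /= ji] _.
  by rewrite mulrC; apply: fps_vanishMl; apply: vX.
by apply: fps_vanishMl; apply: vX.
Qed.

Variable G : {poly fps K}.
Hypotheses (G0 : fps_at0 G`_0 = 0) (G1 : fps_at0 G`_1 = 0).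

Definition picard n : fps K := iter n (fun w => G.[w]) 0.

Lemma picardS n : picard n.+1 = G.[picard n]. Proof. by []. Qed.

Lemma picard_at0 n : fps_vanish 1 (picard n).
Proof.
by apply/fps_vanish1P; elim: n => // n IH; rewrite picardS fps_at0_horner.
Qed.

Lemma picard_step n : fps_vanish n (picard n.+1 - picard n).
Proof.
elim: n => [//|n IH]; rewrite -[_ - _]/(G.[picard n.+1] - G.[picard n]).
by apply: fps_vanish_horner_sub => //; exact: picard_at0.
Qed.

Lemma picard_stable n d : fps_vanish n (picard (n + d) - picard n).
Proof.
elim: d => [|d IH]; first by rewrite addn0 subrr; exact: fps_vanish0.
rewrite -(subrK (picard (n + d)) (picard (n + d.+1))) -addrA.
apply: fps_vanishD => //; apply: (@fps_vanish_le _ n (n + d)).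
  exact: leq_addr.
by rewrite addnS; exact: picard_step.
Qed.

(** The coefficient of index [k] no longer changes after [k + 1] iterations. *)
Definition picard_limit : fps K := fun k => picard k.+1 k.

Lemma picard_limit_coef n k : (k < n)%N -> picard_limit k = picard n k.
Proof.
move=> kn; have := @picard_stable k.+1 (n - k.+1) k (leqnn _).
by rewrite subnKC// fpsD fpsN => /eqP; rewrite subr_eq0 => /eqP.
Qed.

Lemma picard_limit_at0 : fps_vanish 1 picard_limit.
Proof. by move=> k k1; rewrite (picard_limit_coef k1) picard_at0. Qed.

Lemma picard_limitE : G.[picard_limit] = picard_limit.
Proof.
have lim n : fps_vanish n (picard_limit - picard n).
  by move=> k kn; rewrite fpsD fpsN (picard_limit_coef kn) subrr.
apply/eqP; rewrite -subr_eq0; apply/eqP/fps_vanish_eq0 => n.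
rewrite -(subrK (picard n.+1) G.[_]) -addrA; apply: fps_vanishD.
  apply: (fps_vanish_le (leqnSn n)); rewrite picardS.
  apply: fps_vanish_horner_sub => //; [exact: picard_limit_at0|exact: picard_at0].
rewrite -opprB; apply: fps_vanishN; exact: fps_vanish_le (leqnSn n) _.
Qed.

End FormalFixpoint.

(** Synthetic division: the coefficients of the quotient come from those of
  [P] by a recursion from the top degree. *)
Lemma polyOver_factor (A : nzRingType) (S : subringClosed A)
    (P Q : {poly A}) (a : A) :
    P = Q * ('X - a%:P) -> a \in S -> P \is a polyOver S ->
  Q \is a polyOver S.
Proof.
move=> PQ aS /polyOverP PS.
have Qi i : Q`_i = P`_i.+1 + Q`_i.+1 * a.
  by rewrite PQ mulrBr coefB coefMX coefMC/= subrK.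
suff H d i : (size Q <= i + d)%N -> Q`_i \in S.
  by apply/polyOverP => i; apply: (H (size Q)); rewrite leq_addl.
elim: d i => [|d IH] i; first by rewrite addn0 => /(nth_default _) ->; rewrite rpred0.
by move=> Qid; rewrite Qi rpredD ?rpredM ?IH// addSnnS.
Qed.

(** Taylor's formula, valid in all characteristics with the derivatives
  divided by factorials. *)
Lemma coef_comp_poly_XaddC (A : comNzRingType) (P : {poly A}) (a : A) i :
  (P \Po ('X + a%:P))`_i = P^`N(i).[a].
Proof.
have -> : P \Po ('X + a%:P) = \poly_(i < size P) P^`N(i).[a].
  rewrite /comp_poly addrC nderiv_taylor; last exact: mulrC.
  rewrite size_map_polyC poly_def; apply: eq_bigr => j _.
  by rewrite nderivn_map horner_map/= mul_polyC.
rewrite coef_poly; case: ltnP => // Pi.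
by rewrite nderivn_poly0// horner0.
Qed.

Section Convergent.
Variable R : realType.
Implicit Types (a w : fps R[i]) (G H P Q : {poly fps R[i]}).

Lemma fps_bound_seq (s : seq (fps R[i])) :
    {in s, forall a, a \in fps_cvg 0} ->
  exists r M, [/\ 0 < r, 1 <= M & {in s, forall a, fps_bound r M a}].
Proof.
elim: s => [|a s IH] sc; first by exists 1, 1.
have [x xs|r [M [r0 M1 sM]]] := IH; first by rewrite sc// inE xs orbT.
have /fps_cvgP[r' [M' []]] : a \in fps_cvg 0 by rewrite sc// mem_head.
rewrite ComplexField.Normc.normc0 => r0' aM'.
exists (Num.min r r'), (Num.max M M'); split.
- by rewrite lt_min r0 r0'.
- by rewrite le_max M1.
move=> x; rewrite inE => /orP[/eqP ->|xs].
  by apply: fps_bound_le aM'; rewrite ?le_max ?lexx ?orbT// le_min (ltW r0) (ltW r0')/= ge_min lexx orbT.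
by apply: fps_bound_le (sM x xs); rewrite ?le_max ?lexx// le_min (ltW r0) (ltW r0')/= ge_min lexx.
Qed.

Lemma fps_bound0 (r M : R) : 0 <= M -> fps_bound r M (0 : fps R[i]).
Proof.
move=> M0 n; rewrite big1// => i _.
by rewrite ComplexField.Normc.normc0 mul0r.
Qed.

Lemma polyOver_bound G : G \is a polyOver (fps_cvg 0) ->
  exists r M, [/\ 0 < r, 1 <= M & forall i, fps_bound r M G`_i].
Proof.
move=> /polyOverP GS; have [|r [M [r0 M1 GM]]] := @fps_bound_seq G.
  by move=> a /(nthP 0)[i _ <-].
exists r, M; split=> // i; have [iG|Gi] := ltnP i (size G).
  by apply: GM; exact: mem_nth.
by rewrite nth_default//; apply: fps_bound0; rewrite (le_trans ler01).
Qed.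

Lemma fps_bound_sum r n (a : nat -> fps R[i]) (m : nat -> R) : 0 <= r ->
    (forall i, fps_bound r (m i) (a i)) ->
  fps_bound r (\sum_(i < n) m i) (\sum_(i < n) a i).
Proof.
move=> r0 am; elim: n => [|n IH]; first by rewrite !big_ord0; apply: fps_bound0.
by rewrite !big_ord_recr/=; apply: fps_boundD.
Qed.

(** The majorants of the Picard iterates stay in a small ball [d]: in
  [sum_i G_i w^i] the terms with [i >= 2] are at most [M d^2], and the two
  others become as small when the radius shrinks by [d^2]. *)
Lemma picard_limit_cvg G : G \is a polyOver (fps_cvg 0) ->
    fps_at0 G`_0 = 0 -> fps_at0 G`_1 = 0 ->
  picard_limit G \in fps_cvg 0.
Proof.
move=> GS G0 G1; have [r [M [r0 M1 GM]]] := polyOver_bound GS.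
pose D : R := (size G).+1%:R; have D1 : 1 <= D by rewrite ler1n.
have M0 : 0 < M by rewrite (lt_le_trans ltr01).
have D0 : 0 < D by rewrite (lt_le_trans ltr01).
(* Chosen so that [D] terms of size [M d^2] add up to [d]. *)
pose d := (D * M)^-1.
have d0 : 0 < d by rewrite invr_gt0 mulr_gt0.
have d1 : d <= 1 by rewrite invf_le1 ?mulr_gt0// mulr_ege1.
have Md : M * d ^+ 2 = d / D by rewrite /d; field; rewrite !gt_eqF.
have d2 : 0 <= d ^+ 2 <= 1 by rewrite sqr_ge0 expr_le1// ltW.
pose s := r * d ^+ 2.
have s0 : 0 <= s by rewrite mulr_ge0 ?sqr_ge0 ?ltW.
have sr : s <= r by rewrite ger_pMr//; case/andP: d2.
have Gs i : fps_bound s (if (i < 2)%N then M * d ^+ 2 else M) G`_i.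
  case: i => [|[|i]] /=; last by apply: fps_bound_le (GM _); rewrite ?s0.
    rewrite -[X in fps_bound _ (M * X)]expr1; apply: fps_bound_vanish (ltW r0) d2 _ (GM _).
    exact/fps_vanish1P.
  rewrite -[X in fps_bound _ (M * X)]expr1; apply: fps_bound_vanish (ltW r0) d2 _ (GM _).
  exact/fps_vanish1P.
have picd n : fps_bound s d (picard G n).
  elim: n => [|n IH]; first exact/fps_bound0/ltW.
  rewrite picardS horner_coef.
  apply: (@fps_bound_le _ s (\sum_(i < size G) (d / D))); first by rewrite s0/=.
    rewrite sumr_const card_ord -mulr_natl mulrCA ger_pMr//.
    by rewrite ler_pdivrMr// mul1r ler_nat.
  apply: (@fps_bound_sum s _ (fun i => G`_i * picard G n ^+ i) (fun=> d / D)) => // i.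
  apply: fps_bound_le (fps_boundM s0 (Gs i) (fps_boundX i s0 IH)).
    by rewrite s0/=.
  case: ltnP => i2; rewrite -Md.
    rewrite ger_pMr ?mulr_gt0 ?exprn_gt0//; apply: exprn_ile1 => //; exact: ltW.
  by rewrite ler_wpM2l ?(ltW M0)//; apply: ler_wiXn2l => //; exact: ltW.
apply/fps_cvgP; exists s, d; split.
  by rewrite ComplexField.Normc.normc0 mulr_gt0 ?exprn_gt0.
move=> n; rewrite (le_trans _ (picd n n))//; apply: ler_sum => k _.
by rewrite (picard_limit_coef G0 G1 (ltn_ord k)).
Qed.

(** The analytic implicit function theorem for a polynomial equation: after
  division by the derivative [u] the equation is a fixed-point problem whose
  right-hand side has no constant and no linear term at [t = 0]. *)
Lemma implicit_root H : H \is a polyOver (fps_cvg 0) ->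
    fps_at0 H`_0 = 0 -> fps_at0 H`_1 != 0 ->
  exists w, [/\ w \in fps_cvg 0, fps_at0 w = 0 & H.[w] = 0].
Proof.
move=> HS H0 H1; set u := fps_at0 H`_1 in H1.
have CS (c : R[i]) : fpsC c \in fps_cvg 0 by apply: fps_of_poly_cvg.
(* The zeros of [H] are the fixed points of [w - H(w)/u]. *)
pose G := 'X - (fpsC u^-1)%:P * H.
have GS : G \is a polyOver (fps_cvg 0).
  by rewrite rpredB ?polyOverX// rpredM ?polyOverC ?CS.
have G0 : fps_at0 G`_0 = 0.
  rewrite /fps_at0 coefB coefX coefCM fpsD fpsN fpsCM mulr0n fps0 add0r.
  by rewrite [_ 0%N]H0 mulr0 oppr0.
have G1 : fps_at0 G`_1 = 0.
  rewrite /fps_at0 coefB coefX coefCM fpsD fpsN fpsCM mulr1n fps1 mulr1n.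
  by rewrite [u^-1 * _]mulVf// subrr.
exists (picard_limit G); split.
- exact: picard_limit_cvg.
- exact/fps_vanish1P/picard_limit_at0.
set w := picard_limit G; have wE : G.[w] = w := picard_limitE G0 G1.
have uH : fpsC u^-1 * H.[w] = 0.
  have : G.[w] = w - fpsC u^-1 * H.[w].
    by rewrite hornerD hornerN hornerM hornerC hornerX.
  by move/eqP; rewrite wE eq_sym subr_eq addrC -subr_eq subrr eq_sym => /eqP.
apply/funext => k; apply: (mulfI (invr_neq0 H1)); rewrite -fpsCM uH.
by rewrite fps0 mulr0.
Qed.

Lemma fps_shift_cvg n a : a \in fps_cvg 0 -> fps_shift n a \in fps_cvg 0.
Proof.
move=> /fps_cvgP[r [M []]]; rewrite ComplexField.Normc.normc0 => r0 aM.
apply/fps_cvgP; exists r, (M / r ^+ n); rewrite ComplexField.Normc.normc0.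
split=> // m; rewrite ler_pdivlMr ?exprn_gt0// mulr_suml.
apply: le_trans (aM (n + m)%N); rewrite big_split_ord/= -[leLHS]add0r.
rewrite lerD ?sumr_ge0//.
  by move=> i _; rewrite mulr_ge0 ?normc_ge0 ?exprn_ge0// ltW.
by apply: ler_sum => i _; rewrite -mulrA -exprD addnC.
Qed.

Lemma fps_subst_cvg0 N a : (0 < N)%N ->
  a \in fps_cvg 0 -> fps_subst N a \in fps_cvg 0.
Proof. by move=> N0 a0; apply: fps_cvg_subst; rewrite ?expr0n ?gtn_eqF. Qed.

Lemma fps_subst1 (K : comNzRingType) (a : fps K) : fps_subst 1 a = a.
Proof. by apply/funext => k; rewrite /fps_subst dvd1n divn1. Qed.

Lemma fps_orderP (K : comNzRingType) (a : fps K) :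
  a != 0 -> exists v, fps_vanish v a /\ a v != 0.
Proof.
move=> a0; have ex : exists v, a v != 0.
  apply: contra_notP (elimN eqP a0) => /forallNP a0'.
  by apply/funext => k; apply/eqP; rewrite -[_ == _]negbK; exact/negP.
case: (ex_minnP ex) => v av vmin; exists v; split=> // k kv.
by apply: contraTeq kv => /vmin; rewrite leqNgt.
Qed.

End Convergent.

Section Newton.
Variable R : realType.
Implicit Types (a w : fps R[i]) (P Q : {poly fps R[i]}) (p : {poly R[i]}).

Lemma fps_at0C (c : R[i]) : fps_at0 (fpsC c) = c.
Proof. by rewrite /fps_at0 coef_fpsC. Qed.

(** The first edge of the Newton polygon: the least slope [v i / (m - i)]. *)
Lemma min_slope m (v : nat -> nat) (S : pred nat) i1 : (i1 < m)%N -> S i1 ->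
  exists i0, [/\ (i0 < m)%N, S i0 &
    forall i, (i < m)%N -> S i -> (v i0 * (m - i) <= v i * (m - i0))%N].
Proof.
move=> i1m Si1; pose F (i : 'I_m) : rat := (v i)%:R / (m - i)%:R.
have m0 (i : 'I_m) : 0 < (m - i)%:R :> rat by rewrite ltr0n subn_gt0.
case: (@arg_minP _ _ _ (Ordinal i1m) (fun i : 'I_m => S i) F Si1) => i0 Si0 min.
exists i0; split=> // i im Si; have := min (Ordinal im) Si.
by rewrite /F ler_pdivlMr// mulrAC ler_pdivrMr// -!natrM ler_nat.
Qed.

(** For a polynomial of degree [m] without a term of degree [m - 1], in
  characteristic zero, a root of full multiplicity [m] can only be [0]; so a
  further nonzero coefficient forces multiplicity less than [m]. *)
Lemma low_multiplicity p m i0 (x : R[i]) : (0 < m)%N -> (i0 < m)%N ->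
    (size p <= m.+1)%N -> p`_m != 0 -> p`_m.-1 = 0 -> p`_i0 != 0 ->
  exists2 i, (i < m)%N & p^`N(i).[x] != 0.
Proof.
case: m => // m _ i0m pm pm0 /= pm1 pi0.
have [x0|x0] := eqVneq x 0.
  exists i0 => //; rewrite x0 horner_coef0 coef_nderivn addn0 binn mulr1n.
  exact: pi0.
exists m => //; have -> : p^`N(m) = (p`_m.+1 *+ m.+1) *: 'X.
  apply/polyP => -[|[|i]]; rewrite coef_nderivn coefZ coefX.
  - by rewrite addn0 pm1 mul0rn mulr0.
  - by rewrite addn1 binSn mulr1.
  by rewrite mulr0 nth_default ?mul0rn//; apply: leq_trans pm _; lia.
by rewrite hornerZ hornerX mulf_neq0// -mulr_natr mulf_neq0// pnatr_eq0.
Qed.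

(** The order of a zero, read off the Taylor coefficients. *)
Lemma least_derivative p m (x : R[i]) : root p x -> p^`N(m).[x] != 0 ->
  exists2 u, (0 < u <= m)%N &
    (forall i, (i < u)%N -> p^`N(i).[x] = 0) /\ p^`N(u).[x] != 0.
Proof.
move=> px pm; have ex : exists i, p^`N(i).[x] != 0 by exists m.
case: (ex_minnP ex) => u pu umin; exists u.
  rewrite (umin _ pm) andbT lt0n; apply: contraNneq pu => ->.
  by rewrite nderivn0.
split=> // i iu; apply/eqP; apply: contraTT iu => /umin.
by rewrite -leqNgt.
Qed.

Lemma fps_at0_taylor P (c : R[i]) i :
  fps_at0 (P \Po ('X + (fpsC c)%:P))`_i = (map_poly (@fps_at0 _) P)^`N(i).[c].
Proof.
rewrite coef_comp_poly_XaddC -horner_map nderivn_map.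
by rewrite [_ (fpsC c)]fps_at0C.
Qed.

Lemma polyOver_taylor P a : a \in fps_cvg 0 -> P \is a polyOver (fps_cvg 0) ->
  P \Po ('X + a%:P) \is a polyOver (fps_cvg 0).
Proof. by move=> aS PS; rewrite polyOver_comp ?rpredD ?polyOverX ?polyOverC. Qed.

Lemma horner_taylor_subst N P a y :
  (map_poly (fps_subst N) (P \Po ('X + a%:P))).[y] =
  (map_poly (fps_subst N) P).[fps_subst N a + y].
Proof.
rewrite map_comp_poly horner_comp rmorphD/= map_polyX map_polyC/=.
by rewrite hornerD hornerX hornerC addrC.
Qed.

(** One step of the Newton polygon. With [P] having no term of degree [m - 1],
  the substitution [t := t^N], [y := t^k y] along the first edge turns
  [P] into [t^(k m) Q], and a root of [Q] gives a root of [P]. *)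
Lemma newton_edge P m : P \is a polyOver (fps_cvg 0) -> (0 < m)%N ->
    (forall i, (i < m)%N -> fps_at0 P`_i = 0) -> fps_at0 P`_m != 0 ->
    P`_m.-1 = 0 -> P`_0 != 0 ->
  exists N k i0 Q, [/\ (0 < N)%N, Q \is a polyOver (fps_cvg 0),
    [/\ (i0 < m)%N, fps_at0 Q`_i0 != 0, fps_at0 Q`_m != 0,
        fps_at0 Q`_m.-1 = 0 & forall i, (m < i)%N -> fps_at0 Q`_i = 0] &
    forall N' y, (0 < N')%N -> (map_poly (fps_subst N') Q).[y] = 0 ->
      (map_poly (fps_subst (N' * N)) P).[fpsXn _ (N' * k) * y] = 0].
Proof.
move=> PS m0 Plow Pm Pm1 P0.
have [v vP] : exists v : nat -> nat, forall i, P`_i != 0 ->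
    fps_vanish (v i) P`_i /\ P`_i (v i) != 0.
  have H i : exists n, P`_i != 0 -> fps_vanish n P`_i /\ P`_i n != 0.
    have [->|/fps_orderP[n Pn]] := eqVneq P`_i 0; first by exists 0%N.
    by exists n.
  by have [v vP] := choice H; exists v.
have [i0 [i0m Pi0 slope]] := min_slope v (S := fun i => P`_i != 0) m0 P0.
have [vanish_i0 lead_i0] := vP i0 Pi0.
(* The slope is [k / N]; it need not be in lowest terms. *)
pose k := v i0; pose N := (m - i0)%N.
have N0 : (0 < N)%N by rewrite subn_gt0.
have k0 : (0 < k)%N.
  rewrite lt0n; apply: contraNneq lead_i0 => k0; rewrite -/k k0.
  by apply/eqP/Plow.
pose sP i := fps_subst N P`_i.
have sPvanish i : (i <= m)%N -> fps_vanish (k * (m - i)) (sP i).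
  rewrite leq_eqVlt => /orP[/eqP ->|im]; first by rewrite subnn muln0.
  have [Pi|Pi] := eqVneq P`_i 0; first by rewrite /sP Pi rmorph0.
  apply: (@fps_vanish_le _ _ (N * v i)); first by rewrite [(N * _)%N]mulnC; exact: slope.
  by apply: fps_subst_vanish => //; case: (vP i Pi).
pose b i := if (i <= m)%N then fps_shift (k * (m - i)) (sP i)
            else fpsXn _ (k * (i - m)) * sP i.
have bE i : fpsXn _ (k * i) * sP i = fpsXn _ (k * m) * b i.
  rewrite /b; case: leqP => im.
    rewrite -[in LHS](fps_shiftK (sPvanish i im)) mulrA -fpsXnD -mulnDr.
    by rewrite subnKC.
  by rewrite mulrA -fpsXnD -mulnDr subnKC// ltnW.
have sPS i : sP i \in fps_cvg 0.
  by apply: fps_subst_cvg0 => //; move/polyOverP: PS; apply.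
have bS i : b i \in fps_cvg 0.
  rewrite /b; case: ifP => _; first exact: fps_shift_cvg.
  by rewrite rpredM// fps_of_poly_cvg.
have mP : (m < size P)%N.
  rewrite ltnNge; apply: contraNN Pm => Pm'.
  by rewrite nth_default// rmorph0.
pose Q := \poly_(i < size P) b i.
have Qi i : (i <= m)%N -> Q`_i = b i.
  by move=> im; rewrite coef_poly (leq_ltn_trans im mP).
have at0b i : (i <= m)%N -> fps_at0 (b i) = sP i (k * (m - i))%N.
  by move=> im; rewrite /b im /fps_at0 /fps_shift addn0.
exists N, k, i0, Q; split=> //.
- by apply/polyOverP => i; rewrite coef_poly; case: ifP => // _; exact: rpred0.
- split=> //.
  + rewrite Qi ?at0b 1?ltnW// /sP /fps_subst dvdn_mull// mulnK//.
  + by rewrite Qi// at0b// subnn muln0 /sP /fps_subst dvdn0 div0n.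
  + rewrite Qi ?leq_pred// at0b ?leq_pred// /sP Pm1 rmorph0.
    by rewrite fps0.
  + move=> i mi; rewrite coef_poly; case: ifP => _; last exact: rmorph0.
    rewrite /b leqNgt mi/= /fps_at0 coef_fpsXnM muln_gt0 k0 subn_gt0 mi.
    by [].
- move=> N' y N'0 Qy.
  suff -> : (map_poly (fps_subst (N' * N)) P).[fpsXn _ (N' * k) * y] =
      fpsXn _ (N' * (k * m)) * (map_poly (fps_subst N') Q).[y].
    by rewrite Qy mulr0.
  rewrite (@horner_coef_wide _ (size P)); last by rewrite size_poly.
  rewrite [in RHS](@horner_coef_wide _ (size P)); last first.
    by rewrite (leq_trans (size_poly _ _))// size_poly.
  rewrite mulr_sumr; apply: eq_bigr => i _.
  rewrite !coef_map/= coef_poly ltn_ord -fps_subst_subst// -/(sP i).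
  rewrite exprMn fpsXnX mulrCA !mulrA; congr (_ * _).
  rewrite -mulnA -(fps_substXn _ (k * i) N'0) -(fps_substXn _ (k * m) N'0).
  by rewrite -rmorphM bE rmorphM.
Qed.

(** Induction on the multiplicity [m] of the root [0] of [P(0, y)]: either the
  shifted polynomial has the root [0], or its first edge leads to a polynomial
  with a root of smaller multiplicity. *)
Lemma newton_root m P : P \is a polyOver (fps_cvg 0) -> (0 < m)%N ->
    (forall i, (i < m)%N -> fps_at0 P`_i = 0) -> fps_at0 P`_m != 0 ->
  exists N a, [/\ (0 < N)%N, a \in fps_cvg 0 &
    (map_poly (fps_subst N) P).[a] = 0].
Proof.
elim/ltn_ind: m P => m IH P PS m0 Plow Pm.
(* The derivative of order m - 1 has a simple zero, at which the shifted
   polynomial has no term of degree m - 1. *)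
have [h [hS h0 Ph]] : exists h,
    [/\ h \in fps_cvg 0, fps_at0 h = 0 & P^`N(m.-1).[h] = 0].
  apply: implicit_root; first exact: polyOver_nderivn.
    rewrite coef_nderivn addn0 binn mulr1n; apply: Plow.
    by rewrite prednK.
  rewrite coef_nderivn addn1 prednK// -{2}[m]prednK// binSn prednK//.
  by rewrite raddfMn/= -mulr_natr mulf_neq0// pnatr_eq0 -lt0n.
pose P1 := P \Po ('X + h%:P).
have P1S : P1 \is a polyOver (fps_cvg 0) by apply: polyOver_taylor.
have at0P1 i : fps_at0 P1`_i = fps_at0 P`_i.
  by rewrite coef_comp_poly_XaddC fps_at0_horner// coef_nderivn addn0 binn mulr1n.
have P1m1 : P1`_m.-1 = 0 by rewrite coef_comp_poly_XaddC.
have [P10|P10] := eqVneq P1`_0 0.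
  exists 1%N, h; split=> //.
  rewrite (eq_map_poly (@fps_subst1 _)) map_poly_id//.
  by rewrite -[RHS]P10 coef_comp_poly_XaddC nderivn0.
have [||N [k [i0 [Q [N0 QS [i0m Qi0 Qm Qm1 Qhigh] Qroot]]]]] :=
    @newton_edge P1 m P1S m0 _ _ P1m1 P10.
- by move=> i im; rewrite at0P1 Plow.
- by rewrite at0P1.
pose q := map_poly (@fps_at0 _) Q.
have qE i : q`_i = fps_at0 Q`_i by rewrite coef_map.
have sq : size q = m.+1.
  apply/eqP; rewrite eqn_leq; apply/andP; split.
    by apply/leq_sizeP => i mi; rewrite qE Qhigh.
  by rewrite ltnNge; apply: contraNN Qm => /(nth_default _) H; rewrite -qE H.
have /closed_rootP[x qx] : size q != 1 by rewrite sq eqSS -lt0n.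
have [||||j jm qj] := @low_multiplicity q m i0 x m0 i0m; rewrite ?qE ?sq//.
have [u /andP[u0 uj] [qlow qu]] := least_derivative qx qj.
have um := leq_ltn_trans uj jm.
have xS : fpsC x \in fps_cvg 0 by apply: fps_of_poly_cvg.
have [||||N' [a [N'0 aS Qa]]] := IH u um (Q \Po ('X + (fpsC x)%:P)).
- exact: polyOver_taylor.
- by [].
- by move=> i iu; rewrite fps_at0_taylor qlow.
- by rewrite fps_at0_taylor.
exists (N' * N)%N.
exists (fps_subst (N' * N) h + fpsXn _ (N' * k) * (fpsC x + a)).
split; first by rewrite muln_gt0 N'0.
  rewrite rpredD ?fps_subst_cvg0 ?muln_gt0 ?N'0// rpredM ?fps_of_poly_cvg//.
  by rewrite rpredD.
rewrite -horner_taylor_subst; apply: Qroot => //.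
by move: Qa; rewrite horner_taylor_subst fps_substC.
Qed.

(** A root [c] of [P(0, y)] lifts to a root of [P(t^N, y)], and dividing by
  the corresponding factor lowers the degree.  The index [N] is multiplied at
  each step, which replaces [t] by a power of [t] in the roots found before
  and keeps them convergent. *)
Theorem puiseux n P : P \is monic -> P \is a polyOver (fps_cvg 0) ->
    size P = n.+1 ->
  exists N (s : seq (fps R[i])), [/\ (0 < N)%N,
    {in s, forall a, a \in fps_cvg 0} &
    map_poly (fps_subst N) P = \prod_(a <- s) ('X - a%:P)].
Proof.
elim: n P => [|n IH] P Pmonic PS sP.
  exists 1%N, [::]; split=> //; rewrite big_nil.
  rewrite (size1_polyC (eq_leq sP)) map_polyC /=.
  have := monicP Pmonic; rewrite lead_coefE sP => ->.
  by rewrite rmorph1.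
pose p := map_poly (@fps_at0 _) P.
have pmonic : p \is monic by exact: monic_map.
have sp : size p = n.+2 by rewrite size_map_poly_id0 ?sP// (monicP Pmonic) rmorph1 oner_neq0.
have /closed_rootP[x px] : size p != 1 by rewrite sp.
have [|u /andP[u0 _] [plow pu]] := @least_derivative p n.+1 x px.
  rewrite (_ : p^`N(n.+1) = 1) ?hornerC ?oner_neq0//.
  apply/polyP => i; rewrite coef_nderivn coef1; case: i => [|i] /=.
    have := monicP pmonic; rewrite lead_coefE sp addn0 binn mulr1n => ->.
    by [].
  by rewrite nth_default ?mul0rn// sp; lia.
have xS : fpsC x \in fps_cvg 0 by apply: fps_of_poly_cvg.
have [||||N [a [N0 aS Pa]]] := @newton_root u (P \Po ('X + (fpsC x)%:P)).
- exact: polyOver_taylor.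
- by [].
- by move=> i iu; rewrite fps_at0_taylor plow.
- by rewrite fps_at0_taylor.
pose y := fpsC x + a; have yS : y \in fps_cvg 0 by rewrite rpredD.
pose P' := map_poly (fps_subst N) P.
have /factor_theorem[Q PQ] : root P' y.
  apply/rootP; rewrite -[RHS]Pa horner_taylor_subst.
  by congr _.[_ + _]; rewrite fps_substC.
have P'monic : P' \is monic by exact: monic_map.
have Qmonic : Q \is monic by rewrite -(monicMr _ (monicXsubC y)) -PQ.
have sP' : size P' = n.+2.
  by rewrite size_map_poly_id0 ?sP// (monicP Pmonic) rmorph1 oner_neq0.
have sQ : size Q = n.+1.
  by move: sP'; rewrite PQ size_Mmonic ?monicXsubC ?monic_neq0// size_XsubC addn2 => -[].
have P'S : P' \is a polyOver (fps_cvg 0).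
  apply/polyOverP => i; rewrite coef_map/= fps_subst_cvg0//.
  by move/polyOverP: PS; apply.
have [N' [s [N'0 sS Qs]]] := IH Q Qmonic (polyOver_factor PQ yS P'S) sQ.
exists (N' * N)%N, (rcons s (fps_subst N' y)); split.
- by rewrite muln_gt0 N'0.
- move=> b; rewrite mem_rcons inE => /orP[/eqP ->|/sS//].
  exact: fps_subst_cvg0.
have -> : map_poly (fps_subst (N' * N)) P = map_poly (fps_subst N') P'.
  by apply/polyP => i; rewrite !coef_map/= fps_subst_subst.
rewrite PQ rmorphM/= Qs -cats1 big_cat big_seq1/= rmorphB/=.
by rewrite map_polyX map_polyC.
Qed.

End Newton.

(** * Roots by the principal determination *)

Section NthRoot.
Variable R : realType.
Implicit Types z w : R[i].

Lemma cexpD z w : cexp (z + w) = cexp z * cexp w.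
Proof.
case: z w => [a b] [c d]; rewrite /cexp/= expRD rmorphM/= cosD sinD.
rewrite mulrACA; congr (_ * _); apply/eqP; rewrite eq_complex/= eqxx/=.
by apply/eqP; ring.
Qed.

Lemma cexpX z n : cexp z ^+ n = cexp (z * n%:R).
Proof.
elim: n => [|n IH]; last by rewrite exprS IH -natr1 mulrDr mulr1 addrC cexpD.
rewrite expr0 mulr0 /cexp/= expR0 cos0 sin0 mul1r; apply/eqP.
by rewrite eq_complex/= !eqxx.
Qed.

Lemma clogK z : z != 0 -> cexp (clog z) = z.
Proof.
move=> z0; have n0 : 0 < normc z by rewrite normc_gt0.
rewrite /cexp /clog/= lnK ?posrE// /carg.
set n := normc z in n0 *; set x := complex.Re z / n.
have nE : n ^+ 2 = complex.Re z ^+ 2 + complex.Im z ^+ 2.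
  by rewrite /n; case: (z) => a b /=; rewrite sqr_sqrtr// addr_ge0 ?sqr_ge0.
have x1 : -1 <= x <= 1.
  by rewrite -ler_norml normrM normfV (gtr0_norm n0) ler_pdivrMr// mul1r
             normc_Re_le.
have E : Num.sqrt (1 - x ^+ 2) = `|complex.Im z| / n.
  rewrite -[RHS]ger0_norm ?divr_ge0 ?(ltW n0)// -sqrtr_sqr; congr Num.sqrt.
  rewrite /x !exprMn !exprVn real_normK ?num_real//.
  have -> : complex.Im z ^+ 2 = n ^+ 2 - complex.Re z ^+ 2 by rewrite nE; ring.
  by rewrite mulrBl divff// expf_neq0// gt_eqF.
have nx : n * x = complex.Re z by rewrite /x mulrC divfK// gt_eqF.
have nI : n * (complex.Im z / n) = complex.Im z by rewrite mulrC divfK// gt_eqF.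
apply/eqP; rewrite eq_complex/= !mul0r subr0 addr0.
case: ifPn => [I0|I0].
  by rewrite acosK ?in_itv// sin_acos// E ger0_norm// nx nI !eqxx.
rewrite cosN sinN acosK ?in_itv// sin_acos// E ltr0_norm ?ltNge//.
by rewrite mulNr opprK nx nI !eqxx.
Qed.

(** Compatibility of the principal roots of different orders, as both are
  exponentials of multiples of the same logarithm. *)
Lemma nth_rootM N g z : (0 < N)%N -> (0 < g)%N ->
  nth_root (g * N) z ^+ g = nth_root N z.
Proof.
move=> N0 g0; rewrite /nth_root cexpX; congr cexp.
by rewrite natrM invfM mulrA mulrAC divfK// pnatr_eq0 -lt0n.
Qed.

Lemma nth_rootK N z : (0 < N)%N -> z != 0 -> nth_root N z ^+ N = z.
Proof.
by move=> N0 z0; rewrite -{1}[N]muln1 nth_rootM// /nth_root divr1 clogK.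
Qed.

Lemma nth_root_neq0 N z : (0 < N)%N -> z != 0 -> nth_root N z != 0.
Proof.
move=> N0 z0; apply/eqP => r0; have := nth_rootK N0 z0.
by rewrite r0 expr0n gtn_eqF// => /esym/eqP; rewrite (negPf z0).
Qed.

Lemma normc_root1 N z : (0 < N)%N -> z ^+ N = 1 -> normc z = 1.
Proof.
move=> N0 zN; apply/eqP; rewrite -(@pexpr_eq1 _ _ N) ?normc_ge0//.
by rewrite -normcX zN ComplexField.Normc.normc1.
Qed.

End NthRoot.

(** * The homogeneous form of a curve *)

Lemma big_ord_widen0 (V : nmodType) m n (F : nat -> V) : (m <= n)%N ->
  (forall i, (m <= i)%N -> F i = 0) -> \sum_(i < m) F i = \sum_(i < n) F i.
Proof.
move=> mn F0; rewrite -(subnKC mn) big_split_ord/= [X in _ + X]big1 ?addr0//.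
by move=> i _; rewrite F0// leq_addr.
Qed.

Section Form.
Variables (R : realType) (f : {poly {poly R}}).
Local Notation d := (tdegree f).

Lemma leq_tdegree i j : f`_i`_j != 0 -> (i + j <= d)%N.
Proof.
move=> fij; have fi : f`_i != 0 by apply: contraNneq fij => ->; rewrite coef0.
have iS : (i < size f)%N by apply: contraNT fi; rewrite -leqNgt => /(nth_default _)->.
have jS : (j < size (f`_i)%R)%N.
  by apply: contraNT fij; rewrite -leqNgt => /(nth_default _)->.
apply: (@leq_trans (i + (size (f`_i)%R).-1)%N).
  by rewrite leq_add2l -ltnS prednK// (leq_ltn_trans _ jS).
rewrite /tdegree; exact: (@leq_bigmax_cond _ (fun i : 'I_(size f) => f`_i != 0)
  (fun i : 'I_(size f) => (i + (size (f`_i)%R).-1)%N) (Ordinal iS)).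
Qed.

Lemma size_tdegree : (size f <= d.+1)%N.
Proof.
apply/leq_sizeP => i di; apply/polyP => j; rewrite coef0.
apply/eqP; apply: contraTT di => /leq_tdegree ij.
by rewrite -leqNgt -ltnS (leq_ltn_trans (leq_addr j i)).
Qed.

Lemma size_coef_tdegree i : (size (f`_i)%R <= d.+1)%N.
Proof.
apply/leq_sizeP => j dj; apply/eqP; apply: contraTT dj => /leq_tdegree ij.
by rewrite -leqNgt -ltnS (leq_ltn_trans (leq_addl i j)).
Qed.

(** The value of the homogenization, with the same bound for both sums: the
  coefficients added by it are zero. *)
Definition hform (A : comNzRingType) (phi : R -> A) (x y z : A) : A :=
  \sum_(i < d.+1) \sum_(j < d.+1)
    phi f`_i`_j * x ^+ i * y ^+ j * z ^+ (d - i - j).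

Lemma hform_morph (A B : comNzRingType) (psi : {rmorphism A -> B})
    (phi : R -> A) x y z :
  psi (hform phi x y z) = hform (psi \o phi) (psi x) (psi y) (psi z).
Proof.
rewrite /hform rmorph_sum; apply: eq_bigr => i _.
rewrite rmorph_sum; apply: eq_bigr => j _.
by rewrite !rmorphM !rmorphXn.
Qed.

Lemma eval3_homogenization (A : comNzRingType) (phi : {rmorphism R -> A})
  (x y z : A) : eval3 phi (homogenization f) x y z = hform phi x y z.
Proof.
pose T i j : {poly {poly {poly R}}} :=
  ((f`_i`_j *: 'X^(d - i - j)) *: 'X^j) *: 'X^i.
have -> : homogenization f = \sum_(i < d.+1) \sum_(j < d.+1) T i j.
  rewrite -(@big_ord_widen0 _ (size f) _ (fun i => \sum_(j < d.+1) T i j)).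
  - apply: eq_bigr => i _; apply: big_ord_widen0 => [|j fj].
      exact: size_coef_tdegree.
    by rewrite /T [f`_i`_j]nth_default// !scale0r.
  - exact: size_tdegree.
  - move=> i fi; rewrite big1// => j _.
    by rewrite /T [f`_i]nth_default// coef0 !scale0r.
rewrite /eval3.
rewrite rmorph_sum !horner_sum /hform; apply: eq_bigr => i _.
rewrite rmorph_sum !horner_sum; apply: eq_bigr => j _ /=.
rewrite /T map_polyZ map_polyXn/= map_polyZ map_polyXn/= map_polyZ map_polyXn/=.
rewrite hornerZ hornerXn -!polyC_exp hornerM hornerC hornerZ hornerXn.
rewrite hornerM -polyC_exp !hornerM hornerC hornerC hornerZ hornerXn.
ring.
Qed.

Local Notation rc := (real_complex R).

Lemma curveE x y : curve f (x, y) <->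
  \sum_(i < d.+1) \sum_(j < d.+1) rc f`_i`_j * x ^+ i * y ^+ j = 0.
Proof.
rewrite /curve/=; set F := map_poly _ f.
have sF : (size F <= d.+1)%N by rewrite (leq_trans (size_poly _ _)) ?size_tdegree.
suff -> : F.[x, y] =
  \sum_(i < d.+1) \sum_(j < d.+1) rc f`_i`_j * x ^+ i * y ^+ j by [].
rewrite (horner_coef_wide _ sF) horner_sum; apply: eq_bigr => i _.
rewrite coef_map/= hornerM -polyC_exp hornerC.
rewrite (@horner_coef_wide _ d.+1); last first.
  by rewrite (leq_trans (size_poly _ _)) ?size_coef_tdegree.
by rewrite mulr_suml; apply: eq_bigr => j _; rewrite coef_map/= mulrAC.
Qed.

(** [f(x, y) = x^d F(1, y/x, 1/x)]. *)
Lemma curve_hform x y : x != 0 ->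
  curve f (x, y) <-> hform rc 1 (y / x) x^-1 = 0.
Proof.
move=> x0; rewrite curveE.
have <- : x ^+ d * hform rc 1 (y / x) x^-1 =
    \sum_(i < d.+1) \sum_(j < d.+1) rc f`_i`_j * x ^+ i * y ^+ j.
  rewrite mulr_sumr; apply: eq_bigr => i _; rewrite mulr_sumr; apply: eq_bigr => j _.
  have [->|/leq_tdegree ijd] := eqVneq f`_i`_j 0.
    by rewrite rmorph0 !mul0r mulr0.
  rewrite expr1n mulr1 expr_div_n exprVn.
  have -> : x ^+ d = x ^+ i * x ^+ j * x ^+ (d - i - j).
    by rewrite -!exprD; congr (_ ^+ _); lia.
  by field; rewrite !expf_neq0.
split=> [/eqP|->]; last by rewrite mulr0.
by rewrite mulf_eq0 expf_eq0 (negPf x0) andbF/= => /eqP.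
Qed.

(** [F(0, 1, 0)] is the coefficient of [y^d] in [f]. *)
Lemma infinity_point01 : infinity_point f 0 1 <-> f`_0`_d = 0.
Proof.
rewrite /infinity_point eval3_homogenization /hform big_ord_recl/=.
rewrite [X in _ + X]big1 ?addr0; last first.
  by move=> i _; rewrite big1// => j _; rewrite expr0n/= mulr0 !mul0r.
rewrite big_ord_recr/= big1 ?add0r => [|j _]; last first.
  by rewrite subn0 [0 ^+ (d - j)]expr0n subn_eq0 leqNgt ltn_ord mulr0.
rewrite subn0 subnn !expr0 expr1n !mulr1; split=> [|->]; last exact: rmorph0.
by move=> /eqP; rewrite fmorph_eq0 => /eqP.
Qed.

(** [F(1, y, t^N)] as a polynomial in [y] over the power series in [t]. *)
Definition puiseux_poly N : {poly fps R[i]} :=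
  hform (fun r => (fpsC (rc r))%:P) 1 'X (fpsXn _ N)%:P.

Lemma horner_puiseux_poly N a : (puiseux_poly N).[a] =
  hform (fun r => fpsC (rc r)) 1 a (fpsXn _ N).
Proof.
rewrite /puiseux_poly -[LHS]/(horner_eval a _) hform_morph /= /horner_eval.
rewrite hornerC hornerX hornerC.
by apply: eq_bigr => i _; apply: eq_bigr => j _ /=; rewrite hornerC.
Qed.

Lemma map_puiseux_poly M N : (0 < M)%N ->
  map_poly (fps_subst M) (puiseux_poly N) = puiseux_poly (M * N).
Proof.
move=> M0; rewrite /puiseux_poly hform_morph/= rmorph1 map_polyX map_polyC/=.
rewrite fps_substXn//; apply: eq_bigr => i _; apply: eq_bigr => j _ /=.
by rewrite map_polyC/= fps_substC.
Qed.

Lemma coef_puiseux_poly N k : (puiseux_poly N)`_k =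
  \sum_(i < d.+1) \sum_(j < d.+1)
    if j == k :> nat then fpsC (rc f`_i`_j) * fpsXn _ N ^+ (d - i - j) else 0.
Proof.
rewrite coef_sum; apply: eq_bigr => i _; rewrite coef_sum; apply: eq_bigr => j _.
rewrite expr1n mulr1 -polyC_exp coefMC coefCM coefXn eq_sym.
by case: eqP => _; rewrite ?mulr1// mulr0 mul0r.
Qed.

Lemma puiseux_poly_cvg N t : puiseux_poly N \is a polyOver (fps_cvg t).
Proof.
apply/polyOverP => k; rewrite coef_puiseux_poly.
apply: rpred_sum => i _; apply: rpred_sum => j _; case: ifP => _; last exact: rpred0.
by rewrite rpredM ?rpredX ?fps_of_poly_cvg.
Qed.

(** The coefficient of [y^d] in the homogenization is a form of degree [0]. *)
Lemma puiseux_poly_lead N : f`_0`_d != 0 ->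
  (puiseux_poly N)`_d = fpsC (rc f`_0`_d) /\ size (puiseux_poly N) = d.+1.
Proof.
move=> fd.
have coefd : (puiseux_poly N)`_d = fpsC (rc f`_0`_d).
  rewrite coef_puiseux_poly big_ord_recl/= [X in _ + X]big1 ?addr0 => [|i _].
    rewrite big_ord_recr/= eqxx big1 ?add0r => [|j _].
      by rewrite subn0 subnn expr0 mulr1.
    by rewrite ltn_eqF.
  rewrite big1// => j _; case: eqP => // jd.
  have [->|/leq_tdegree] := eqVneq f`_(bump 0 i)`_j 0.
    by rewrite !rmorph0 mul0r.
  by rewrite jd /bump/=; lia.
split=> //; apply/eqP; rewrite eqn_leq; apply/andP; split.
  apply/leq_sizeP => k dk; rewrite coef_puiseux_poly.
  rewrite big1// => i _; rewrite big1// => j _; case: eqP => // jk.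
  by have := ltn_ord j; rewrite jk ltnNge dk.
rewrite ltnNge; apply: contraNN fd => sd.
have := congr1 (fun a : fps R[i] => a 0%N) (nth_default 0 sd).
by rewrite coefd coef_fpsC/= fps0 => /eqP; rewrite fmorph_eq0.
Qed.

Lemma fps_value_hform t a b v w : fps_value t a v -> fps_value t b w ->
  fps_value t (hform (fun r => fpsC (rc r)) 1 a b) (hform rc 1 v w).
Proof.
move=> av bw; apply: fps_value_sum => i; apply: fps_value_sum => j.
apply: fps_valueM; last exact: fps_valueX.
apply: fps_valueM; last exact: fps_valueX.
apply: fps_valueM; first exact: fps_valueC.
by rewrite !expr1n -(rmorph1 (@fpsC R[i])); exact: fps_valueC.
Qed.

Lemma dvdp_Xn_vanish n (p : {poly R[i]}) :
  ('X^n %| p) <-> fps_vanish n (fps_of_poly p).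
Proof.
split=> [/dvdpP[q ->] k kn|v]; first by rewrite /fps_of_poly coefMXn kn.
apply/dvdpP; exists (drop_poly n p).
rewrite -[p in LHS](poly_take_drop n) [take_poly n p](_ : _ = 0) ?add0r//.
by apply/polyP => k; rewrite coef_take_poly coef0; case: ifP => // /v.
Qed.

Lemma fps_vanish_horner (K : comNzRingType) n (P : {poly fps K}) a b :
  fps_vanish n (a - b) -> fps_vanish n (P.[a] - P.[b]).
Proof.
move=> ab; rewrite !horner_coef -sumrB; apply: fps_vanish_sum => i _.
rewrite -mulrBr subrXX; apply: fps_vanishMl.
by rewrite mulrC; apply: fps_vanishMl.
Qed.

(** Replacing the series by its truncation at order [n] changes the value of
  the polynomial by terms of order at least [n]. *)
Lemma puiseux_solutionP N a : (0 < N)%N ->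
  puiseux_solution f N a <-> (puiseux_poly N).[a : fps R[i]] = 0.
Proof.
move=> N0; pose E n := eval3 (polyC \o rc) (homogenization f)
  1 (\poly_(k < n) a k) ('X^N).
have EE n : fps_of_poly (E n) =
    (puiseux_poly N).[fps_of_poly (fps_trunc n (a : fps R[i]))].
  rewrite /E eval3_homogenization hform_morph rmorph1 horner_puiseux_poly.
  by [].
have diff n := fps_vanish_horner (puiseux_poly N)
  (@fps_vanish_trunc _ n (a : fps R[i])).
split=> [sol|sol n].
  apply: fps_vanish_eq0 => n; rewrite -(subrK (fps_of_poly (E n)) _.[_]).
  apply: fps_vanishD; first by rewrite EE.
  exact/dvdp_Xn_vanish/sol.
apply/dvdp_Xn_vanish; rewrite -/(E n) EE -[X in fps_vanish _ X]opprK.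
by apply: fps_vanishN; rewrite -[- _]add0r -sol; exact: diff.
Qed.

End Form.

(** * Infinity branches and their leaves *)

Section Branches.
Variable R : realType.
Implicit Types (f g : {poly {poly R}}) (a : fps R[i]) (x y z t v c : R[i]).

Lemma normc_nth_rootV N x : (0 < N)%N -> x != 0 ->
  normc (nth_root N x)^-1 ^+ N = (normc x)^-1.
Proof.
by move=> N0 x0; rewrite -normcX exprVn nth_rootK// ComplexField.Normc.normcV.
Qed.

Lemma nth_rootV_small N (e : R) : (0 < N)%N -> 0 < e ->
  exists2 X, 0 < X & forall x, X < normc x ->
    x != 0 /\ normc (nth_root N x)^-1 < e.
Proof.
move=> N0 e0; exists (e ^+ N)^-1; first by rewrite invr_gt0 exprn_gt0.
move=> x Xx.
have nx : 0 < normc x by rewrite (lt_trans _ Xx)// invr_gt0 exprn_gt0.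
have x0 : x != 0 by rewrite -normc_gt0.
split=> //; rewrite -(ltr_pXn2r N0) ?nnegrE ?normc_ge0 ?(ltW e0)//.
by rewrite normc_nth_rootV// invf_plt ?posrE// exprn_gt0.
Qed.

(** A leaf over [z] is [z] times a power series at [c z^(-1/N)]. *)
Lemma series_conj_term N a c z n :
  series (conj_term N a c z) n = z * (fps_trunc n a).[c / nth_root N z].
Proof.
rewrite /series/= big_mkord horner_poly mulr_sumr; apply: eq_bigr => k _.
by rewrite /conj_term expr_div_n; ring.
Qed.

Lemma cvg_conj_term N a c z v : fps_value (c / nth_root N z) a v ->
  series (conj_term N a c z) @ \oo --> (z * v : R[i]^o).
Proof.
move=> [_ av]; apply: (cvgc_ext (cvgcM (@cvgc_cst _ z) av)) => n.
by rewrite series_conj_term.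
Qed.

Lemma branch_leaf_value f (B : infinity_branch f) c z v :
    fps_value (c / nth_root (branch_index B) z) (branch_coef B) v ->
  leaf_fun (branch_leaf B c) z = z * v.
Proof.
move=> /cvg_conj_term cv; rewrite /branch_leaf/=.
exact: (cvg_lim (@norm_hausdorff _ (R[i]^o)) cv).
Qed.

Lemma branch_index_gt0 f (B : infinity_branch f) : (0 < branch_index B)%N.
Proof. by case: (branch_ramification B). Qed.

(** The convergence at a single point bounds the terms of the series there. *)
Lemma branch_bound f (B : infinity_branch f) :
  exists r M, 0 < r /\ fps_bound r M (branch_coef B).
Proof.
pose N := branch_index B; have N0 : (0 < N)%N := branch_index_gt0 B.
pose z : R[i] := (branch_radius B + 1)%:C.
have Xz : branch_radius B < normc z.
  by rewrite normc_real (lt_le_trans _ (ler_norm _))// ltrDl.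
have nz : 0 < normc z by rewrite (lt_trans (branch_radius_gt0 B)).
have z0 : z != 0 by rewrite -normc_gt0.
pose t := (nth_root N z)^-1.
have t0 : 0 < normc t by rewrite normc_gt0 invr_neq0// nth_root_neq0.
have termE k : normc (conj_term N (branch_coef B) 1 z k) =
    normc z * (normc (branch_coef B k) * normc t ^+ k).
  rewrite /conj_term expr1n mulr1 -exprVn !ComplexField.Normc.normcM normcX.
  by rewrite mulrCA.
have /cvg_series_cvg_0/cvgcP/(_ 1 ltr01)[n0 Hn0] :=
  @branch_cvg R f B 1 z (expr1n _ _) Xz.
pose S := 1 + \sum_(k < n0) normc (conj_term N (branch_coef B) 1 z k).
have le k : normc (conj_term N (branch_coef B) 1 z k) <= S.
  have S0 : 0 <= \sum_(k < n0) normc (conj_term N (branch_coef B) 1 z k).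
    by apply: sumr_ge0 => i _; exact: normc_ge0.
  have [/Hn0|kn] := leqP n0 k.
    by rewrite sub0r normcN => /ltW/le_trans; apply; rewrite lerDl.
  rewrite /S (bigD1 (Ordinal kn))//= addrCA lerDl addr_ge0// sumr_ge0// => i _.
  exact: normc_ge0.
exists (normc t / 2), (2 * (S / normc z)); split; first by rewrite divr_gt0.
apply: fps_bound_of_terms; first exact: ltW.
by move=> k; rewrite ler_pdivlMr// mulrC -termE.
Qed.

(** Taking values turns the formal identity [F(1, phi, t^N) = 0] into a
  numerical one at [t = c x^(-1/N)], where [t^N = 1/x]. *)
Lemma leaf_on_curve g N a c x v : (0 < N)%N -> (puiseux_poly g N).[a] = 0 ->
    c ^+ N = 1 -> x != 0 -> fps_value (c / nth_root N x) a v ->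
  curve g (x, x * v).
Proof.
move=> N0 ga c1 x0 av; apply/curve_hform => //.
have tN : (c / nth_root N x) ^+ N = x^-1.
  by rewrite expr_div_n c1 nth_rootK// mul1r.
rewrite mulrAC divff// mul1r -tN.
have := fps_value_hform g av (fps_valueXn _ N); rewrite -horner_puiseux_poly ga.
move/fps_value_uniq; apply.
by have := fps_valueC (c / nth_root N x) 0; rewrite rmorph0.
Qed.

(** Dividing [N] and all exponents by their common divisor turns any root of
  the polynomial into a branch. *)
Lemma branch_of_root f N a : (0 < N)%N -> a \in fps_cvg 0 ->
    (puiseux_poly f N).[a] = 0 ->
  exists (B : infinity_branch f) q, [/\ (0 < q)%N, N = (q * branch_index B)%N &
    a = fps_subst q (branch_coef B)].
Proof.
move=> N0 a0 fa.
pose common D := `[< (0 < D)%N /\ forall k, a k != 0 -> (N %| D * k)%N >].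
have exD : exists D, common D.
  by exists N; apply/asboolP; split=> // k _; exact: dvdn_mulr.
case: (ex_minnP exD) => N' /asboolP[N'0 N'a] N'min.
have /dvdnP[q Nq] : (N' %| N)%N.
  rewrite /dvdn -leqn0 leqNgt; apply/negP => r0.
  have := N'min (N %% N')%N; rewrite leqNgt ltn_mod N'0/= => H.
  suff /H : common (N %% N')%N by [].
  apply/asboolP; split=> // k /N'a Nk.
  rewrite -(dvdn_addr _ (dvdn_mull ((N %/ N') * 1)%N Nk)) muln1 mulnA -mulnDl.
  by rewrite -divn_eq dvdn_mulr.
have q0 : (0 < q)%N by move: N0; rewrite Nq muln_gt0 => /andP[].
have aq k : a k != 0 -> (q %| k)%N.
  by move/N'a; rewrite Nq mulnC dvdn_pmul2l.
pose b : fps R[i] := fun k => a (q * k)%N.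
have ab : a = fps_subst q b.
  apply/funext => k; rewrite /fps_subst; case: ifPn => [/dvdnP[j ->]|qk].
    by rewrite mulnK// /b mulnC.
  by apply/eqP; apply: contraNT qk; exact: aq.
have fb : (puiseux_poly f N').[b] = 0.
  apply: (fps_subst_inj q0); rewrite rmorph0 -fa ab Nq -map_puiseux_poly//.
  by rewrite horner_map.
have ram : ramification_index N' b.
  split=> // D D0 Db; apply: N'min; apply/asboolP; split=> // k ak.
  have /dvdnP[j kj] := aq k ak.
  have /Db Dj : b j != 0 by rewrite /b mulnC -kj.
  by rewrite kj Nq [(D * _)%N]mulnA [(D * j * q)%N]mulnC dvdn_pmul2l.
have point : infinity_point f 1 (b 0%N).
  rewrite /infinity_point eval3_homogenization.
  have := congr1 (@fps_at0 R[i]) fb.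
  rewrite horner_puiseux_poly hform_morph/= rmorph1 rmorph0.
  have -> : fps_at0 (fpsXn R[i] N') = 0.
    by rewrite /fps_at0 coef_fpsXn; case: (N') N'0.
  move=> h0; rewrite -[RHS]h0; apply: eq_bigr => i _; apply: eq_bigr => j _.
  by rewrite /= [fps_at0 (fpsC _)]fps_at0C.
have sol : puiseux_solution f N' b by apply/puiseux_solutionP.
have /fps_cvgP[r [M []]] := a0; rewrite ComplexField.Normc.normc0 => r0 aM.
have [X X0 HX] := nth_rootV_small N'0 (exprn_gt0 q r0).
have bM : fps_bound (r ^+ q) M b.
  move=> n; apply: le_trans (aM (q * n)%N).
  elim: n => [|n IH]; first by rewrite muln0 !big_ord0.
  rewrite big_ord_recr/= mulnS addnC big_split_ord/=; apply: lerD => //.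
  rewrite -(prednK q0) big_ord_recl/= (prednK q0) addn0 -exprM lerDl.
  by rewrite sumr_ge0// => i _; rewrite mulr_ge0 ?normc_ge0 ?exprn_ge0 ?ltW.
have cvgb c z : c ^+ N' = 1 -> X < normc z -> cvgn (series (conj_term N' b c z)).
  move=> c1 /HX[z0 zr].
  have [|v bv] := @fps_value_ex _ (c / nth_root N' z) b.
    apply/fps_cvgP; exists (r ^+ q), M; split=> //.
    by rewrite ComplexField.Normc.normcM (normc_root1 N'0 c1) mul1r.
  by apply/cvg_ex; exists (z * v); exact: cvg_conj_term.
by exists (InfinityBranch point ram sol X0 cvgb), q; split.
Qed.

End Branches.

(** * Curves with the same asymptotic behavior *)

Section Asymptotic.
Variable R : realType.
Implicit Types (f g : {poly {poly R}}) (a : fps R[i]) (x y z t v c : R[i]).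

Lemma convergent_leaves_bounded (L L' : leaf R) : convergent_leaves L L' ->
  exists X, forall z, X < normc z -> normc (leaf_fun L' z - leaf_fun L z) <= 1.
Proof.
move=> cL; have [X _ HX] := cL _ (nbhsx_ballx (0 : R[i]^o) 1 ltr01).
exists X => z /HX; rewrite /= -ball_normE/= sub0r normrN norm_normc ltcE.
by case/andP=> _ /ltW.
Qed.

(** Convergent leaves, as series in [s = x^(-1/M)], agree to order [M] before
  the factor [s^(-M)]; the agreement is preserved by rotating [s], hence it
  holds for the principal leaf of [B] and a suitable leaf of [B']. *)
Lemma branch_close f g (B : infinity_branch f) (B' : infinity_branch g) :
    convergent_branches B B' ->
  exists X C, forall x v, X < normc x ->
    fps_value (nth_root (branch_index B) x)^-1 (branch_coef B) v ->
    exists2 y, curve g (x, y) & normc (x * v - y) <= C.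
Proof.
move=> [L [L' [[c /= c1 <-] [c' /= c1' <-] /convergent_leaves_bounded[X1 HX1]]]].
set N := branch_index B in c1 *; set N' := branch_index B' in c1'.
have N0 : (0 < N)%N := branch_index_gt0 B.
have N'0 : (0 < N')%N := branch_index_gt0 B'.
pose M := (N * N')%N; have M0 : (0 < M)%N by rewrite muln_gt0 N0.
have [r [K [r0 aK]]] := branch_bound B.
have [r' [K' [r'0 aK']]] := branch_bound B'.
pose a : fps R[i] := branch_coef B; pose a' : fps R[i] := branch_coef B'.
(* Both leaves are power series in the same s = x^(-1/M). *)
pose al := fps_subst N' (fps_scale c a).
pose al' := fps_subst N (fps_scale c' a').
have valueL s v : fps_value (c * s ^+ N') a v -> fps_value s al v.
  by move=> av; apply/fps_value_subst/fps_value_scale => //; exact: normc_root1 c1.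
have valueL' s v : fps_value (c' * s ^+ N) a' v -> fps_value s al' v.
  by move=> av; apply/fps_value_subst/fps_value_scale => //; exact: normc_root1 c1'.
have cvga t : normc t < r -> exists v, fps_value t a v.
  by move=> tr; apply: fps_value_ex; apply/fps_cvgP; exists r, K.
have cvga' t : normc t < r' -> exists v, fps_value t a' v.
  by move=> tr; apply: fps_value_ex; apply/fps_cvgP; exists r', K'.
have [X2 X20 HX2] := nth_rootV_small N0 r0.
have [X3 X30 HX3] := nth_rootV_small N'0 r'0.
pose s x := (nth_root M x)^-1.
have sN' x : s x ^+ N' = (nth_root N x)^-1.
  by rewrite /s exprVn /M mulnC nth_rootM.
have sN x : s x ^+ N = (nth_root N' x)^-1 by rewrite /s exprVn nth_rootM.
pose D := al' - al.
have [r1 [K1 [r10 DK]]] : exists r1 K1, 0 < r1 /\ fps_bound r1 K1 D.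
  have H0 (b : fps R[i]) u : 0 < u -> (exists w, fps_bound u w b) ->
      b \in fps_cvg 0.
    move=> u0 [w uw]; apply/fps_cvgP; exists u, w.
    by rewrite ComplexField.Normc.normc0.
  have : D \in fps_cvg 0.
    rewrite rpredB// fps_subst_cvg0//.
      apply: (H0 _ _ r'0); exists K'; apply: fps_bound_scale => //.
      exact: normc_root1 c1'.
    apply: (H0 _ _ r0); exists K; apply: fps_bound_scale => //.
    exact: normc_root1 c1.
  by case/fps_cvgP=> r1 [K1]; rewrite ComplexField.Normc.normc0; exists r1, K1.
(* The difference of the leaves is s^(-M) D(s), so D vanishes to order M. *)
have DM : fps_vanish M D.
  apply: (fps_vanish_of_small r10 DK) => e e0.
  have [X4 X40 HX4] := nth_rootV_small M0 e0.
  have [x nx] : exists x : R[i], normc x = `|X1| + X2 + X3 + X4 + 1.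
    exists (`|X1| + X2 + X3 + X4 + 1)%:C.
    by rewrite normc_real ger0_norm// !addr_ge0// ltW.
  have X1x : X1 < normc x.
    by rewrite nx; have := ler_norm X1; have := normr_ge0 X1; lra.
  have [X2x X3x X4x] : [/\ X2 < normc x, X3 < normc x & X4 < normc x].
    by rewrite nx; have := normr_ge0 X1; split; lra.
  have [x0 sa] := HX2 x X2x; have [_ sa'] := HX3 x X3x; have [_ se] := HX4 x X4x.
  have [|v av] := cvga (c / nth_root N x).
    by rewrite ComplexField.Normc.normcM (normc_root1 N0 c1) mul1r.
  have [|v' av'] := cvga' (c' / nth_root N' x).
    by rewrite ComplexField.Normc.normcM (normc_root1 N'0 c1') mul1r.
  exists (s x), (v' - v); split.
  - by rewrite invr_neq0// nth_root_neq0.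
  - exact: se.
  - apply: fps_valueB; [apply: valueL'; rewrite sN|apply: valueL; rewrite sN'];
      by [].
  have le1 : normc (x * v' - x * v) <= 1.
    have := HX1 x X1x; congr (normc (_ - _) <= _).
      exact: branch_leaf_value av'.
    exact: branch_leaf_value av.
  move: le1; rewrite -mulrBr ComplexField.Normc.normcM normc_nth_rootV// => le1.
  by rewrite -[leRHS]mul1r ler_pdivlMr ?normc_gt0// mulrC.
(* Rotating s by om moves the chosen leaf of B to the one with c = 1. *)
pose om := nth_root N' c^-1.
have c0 : c != 0.
  apply/eqP => c0; move: c1; rewrite c0 expr0n gtn_eqF// => /esym/eqP.
  by rewrite oner_eq0.
have omN' : om ^+ N' = c^-1 by rewrite nth_rootK// invr_neq0.
have omM : om ^+ M = 1 by rewrite /M mulnC exprM omN' exprVn c1 invr1.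
have om1 : normc om = 1 by exact: normc_root1 omM.
have c2 : (c' * om ^+ N) ^+ N' = 1 by rewrite exprMn c1' mul1r -exprM.
have [X5 X50 HX5] := nth_rootV_small M0 r10.
exists (X2 + X3 + X5), (K1 / r1 ^+ M) => x v Xx av.
have [X2x X3x X5x] : [/\ X2 < normc x, X3 < normc x & X5 < normc x].
  by split; lra.
have [x0 _] := HX2 x X2x; have [_ sa'] := HX3 x X3x; have [_ sr1] := HX5 x X5x.
have [|v' av'] := cvga' (c' * om ^+ N / nth_root N' x).
  by rewrite ComplexField.Normc.normcM (normc_root1 N'0 c2) mul1r.
exists (x * v').
  have ga' := (puiseux_solutionP _ _ N'0).1 (branch_solution B').
  exact: leaf_on_curve N'0 ga' c2 x0 av'.
have Dv : fps_value (om * s x) D (v' - v).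
  apply: fps_valueB; [apply: valueL'|apply: valueL]; rewrite exprMn.
    by rewrite mulrA sN.
  rewrite omN' mulrA (divff c0) mul1r sN'; exact: av.
have som : normc (om * s x) = normc (s x).
  by rewrite ComplexField.Normc.normcM om1 mul1r.
have := fps_value_le r10 _ DM DK Dv; rewrite som => /(_ (ltW sr1)).
rewrite expr_div_n normc_nth_rootV// => le1.
rewrite -mulrBr ComplexField.Normc.normcM normcB mulrC -ler_pdivlMr ?normc_gt0//.
by rewrite (le_trans le1)// mulrA mulrAC.
Qed.

(** The values lie in a field, so a product of value [0] has a factor of
  value [0]. *)
Lemma fps_value_prod t w (s : seq (fps R[i])) :
    {in s, forall a, a \in fps_cvg t} ->
    fps_value t (\prod_(a <- s) (fpsC w - a)) 0 ->
  exists2 a, a \in s & fps_value t a w.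
Proof.
elim: s => [|a s IH] sS.
  rewrite big_nil -(rmorph1 (@fpsC R[i])) => /(fps_value_uniq (fps_valueC t 1)).
  by move/eqP; rewrite oner_eq0.
have [v av] := fps_value_ex (sS a (mem_head _ _)).
have sS' : {in s, forall a, a \in fps_cvg t}.
  by move=> b bs; apply: sS; rewrite inE bs orbT.
have prodS : \prod_(a <- s) (fpsC w - a) \in fps_cvg t.
  rewrite big_seq; apply: rpred_prod => b bs.
  by apply: rpredB; [exact: fps_of_poly_cvg|exact: sS'].
have [u pu] := fps_value_ex prodS.
rewrite big_cons => H.
have /eqP := fps_value_uniq (fps_valueM (fps_valueB (fps_valueC t w) av) pu) H.
rewrite mulf_eq0 subr_eq0 => /orP[/eqP wv|/eqP u0].
  by exists a; [exact: mem_head|rewrite wv].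
have [|b bs bw] := IH sS'; first by rewrite -u0.
by exists b => //; rewrite inE bs orbT.
Qed.

Lemma bounds_seq (T : eqType) (s : seq T) (P : T -> R -> R -> Prop) :
    (forall p X C X' C', X <= X' -> C <= C' -> P p X C -> P p X' C') ->
    {in s, forall p, exists X C, P p X C} ->
  exists X C, {in s, forall p, P p X C}.
Proof.
move=> Pmono; elim: s => [|p s IH] sP; first by exists 0, 0.
have [q qs|X [C XC]] := IH; first by apply: sP; rewrite inE qs orbT.
have [X' [C' pXC']] := sP p (mem_head _ _).
exists (Num.max X X'), (Num.max C C') => q; rewrite inE => /orP[/eqP ->|qs].
  by apply: Pmono pXC'; rewrite le_max lexx orbT.
by apply: Pmono (XC q qs); rewrite le_max lexx.
Qed.

(** The points of the curve over a large [x] are given by its Puiseux roots;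
  each of these is a branch, so it is close to some branch of [g]. *)
Lemma far_points f g : f`_0`_(tdegree f) != 0 ->
    (forall B : infinity_branch f, exists B' : infinity_branch g,
       convergent_branches B B') ->
  exists X C, forall x y, X < normc x -> curve f (x, y) ->
    exists2 y', curve g (x, y') & normc (y - y') <= C.
Proof.
move=> fd asym; pose e : R[i] := (f`_0`_(tdegree f))%:C.
have e0 : e != 0 by rewrite fmorph_eq0.
have [lead sizeP] := puiseux_poly_lead 1 fd; rewrite -/e in lead.
pose P := (fpsC e^-1)%:P * puiseux_poly f 1.
have eC : fpsC e * fpsC e^-1 = 1 by rewrite -rmorphM divff// rmorph1.
have eP : (fpsC e)%:P * P = puiseux_poly f 1.
  by rewrite mulrA -polyCM eC mul1r.
have coefP k : P`_k = fpsC e^-1 * (puiseux_poly f 1)`_k by rewrite coefCM.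
have sP : size P = (tdegree f).+1.
  apply/eqP; rewrite eqn_leq; apply/andP; split.
    apply/leq_sizeP => k kd; rewrite coefP nth_default ?mulr0// sizeP.
    exact: kd.
  rewrite ltnNge; apply/negP => sPd.
  have := congr1 (fun a : fps R[i] => a 0%N) (nth_default 0 sPd).
  rewrite coefP lead fpsCM coef_fpsC/= mulVf// fps0 => /eqP.
  by rewrite oner_eq0.
have Pmonic : P \is monic.
  by rewrite monicE lead_coefE sP/= coefP lead mulrC eC.
have PS : P \is a polyOver (fps_cvg 0).
  by rewrite rpredM ?puiseux_poly_cvg// polyOverC fps_of_poly_cvg.
have [N [s [N0 sS Ps]]] := puiseux Pmonic PS sP.
have mapP : (fpsC e)%:P * map_poly (fps_subst N) P = puiseux_poly f N.
  rewrite -[N in RHS]muln1 -map_puiseux_poly// -eP [RHS]rmorphM/= map_polyC/=.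
  by rewrite fps_substC.
have [r [K [r0 _ sK]]] := fps_bound_seq sS.
have [X0 X00 HX0] := nth_rootV_small N0 r0.
pose close a X C := forall x v, X < normc x ->
  fps_value (nth_root N x)^-1 a v ->
  exists2 y', curve g (x, y') & normc (x * v - y') <= C.
have [||X [C XC]] := @bounds_seq _ s close.
- move=> a X C X' C' XX' CC' aXC x v Xx av.
  have [|y' gy le] := aXC x v _ av; first exact: le_lt_trans XX' Xx.
  by exists y' => //; exact: le_trans CC'.
- move=> a sa; have fa : (puiseux_poly f N).[a] = 0.
    rewrite -mapP hornerM Ps horner_prod (big_rem a)//= hornerXsubC subrr.
    by rewrite mul0r mulr0.
  have [B [q [q0 Nq aq]]] := branch_of_root N0 (sS a sa) fa.
  have [B' BB'] := asym B; have [X [C XC]] := branch_close BB'.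
  have N'0 := branch_index_gt0 B.
  have [rb [Kb [rb0 bK]]] := branch_bound B.
  have [Xb _ HXb] := nth_rootV_small N'0 rb0.
  exists (Num.max X Xb), C => x v; rewrite gt_max => /andP[Xx Xbx] av.
  apply: (XC x v Xx).
  have [|v' bv'] := @fps_value_ex _ (nth_root (branch_index B) x)^-1 (branch_coef B).
    by apply/fps_cvgP; exists rb, Kb; split=> //; case: (HXb x Xbx).
  suff vv' : v = v' by rewrite vv'; exact: bv'.
  apply: (fps_value_uniq av); rewrite aq; apply: (fps_value_subst q0).
  by rewrite exprVn Nq nth_rootM.
exists (Num.max X X0), C => x y; rewrite gt_max => /andP[Xx X0x] fxy.
have [x0 tr] := HX0 x X0x; pose t := (nth_root N x)^-1.
have [||a sa av] := @fps_value_prod t (y / x) s.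
- by move=> a sa; apply/fps_cvgP; exists r, K; split=> //; exact: sK.
- have tN : t ^+ N = x^-1 by rewrite /t exprVn nth_rootK.
  have := fps_value_hform f (fps_valueC t (y / x)) (fps_valueXn t N).
  rewrite -horner_puiseux_poly tN ((curve_hform f y x0).1 fxy) => H.
  have := fps_valueM (fps_valueC t e^-1) H.
  rewrite mulr0 -mapP hornerM hornerC mulrA mulrC [fpsC e^-1 * _]mulrC eC.
  rewrite mulr1 Ps horner_prod.
  by under eq_bigr do rewrite hornerXsubC.
have [y' gy' le] := XC a sa x (y / x) Xx av.
by exists y' => //; rewrite -[y in y - y'](divfK x0) mulrC.
Qed.

End Asymptotic.

(** * The Hausdorff distance *)

Section Hausdorff.
Variable R : realType.
Implicit Types (f g : {poly {poly R}}) (x y : R[i]).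

(** Where [|y| > 1], the leading term [e y^d] is cancelled by terms of degree
  less than [d] in [y], hence [|e| |y|^d] is at most a constant times
  [|y|^(d-1)]. *)
Lemma near_points_bounded f (X : R) : f`_0`_(tdegree f) != 0 ->
  exists C, forall x y, normc x <= X -> curve f (x, y) -> normc y <= C.
Proof.
set d := tdegree f => fd; pose e : R[i] := (f`_0`_d)%:C.
have e0 : 0 < normc e by rewrite normc_gt0 fmorph_eq0.
pose S := \sum_(i < d.+1) \sum_(j < d.+1) normc (f`_i`_j)%:C * X ^+ i.
(* Each term other than [e y^d], multiplied by [y], has degree at most [d]. *)
exists (Num.max 1 (S / normc e)) => x y xX; rewrite curveE -/d => fxy.
rewrite le_max; have [le1|y1] := leP (normc y) 1; first by [].
rewrite orFb.
have y0 : 0 < normc y by rewrite (lt_trans _ y1).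
pose G (i j : nat) : R[i] := if (i == 0%N) && (j == d) then 0
  else (f`_i`_j)%:C * x ^+ i * y ^+ j.
have E : e * y ^+ d + \sum_(i < d.+1) \sum_(j < d.+1) G i j = 0.
  rewrite -[RHS]fxy big_ord_recl [RHS]big_ord_recl/= addrA; congr (_ + _).
  rewrite big_ord_recr [RHS]big_ord_recr/= /G !eqxx/= addr0 expr0 mulr1 addrC.
  congr (_ + _); apply: eq_bigr => j _.
  by rewrite ltn_eqF.
have GS : normc (\sum_(i < d.+1) \sum_(j < d.+1) G i j) * normc y
    <= S * normc y ^+ d.
  rewrite (le_trans (ler_wpM2r (normc_ge0 y) (normc_sum _ _ _)))//.
  rewrite /S !mulr_suml; apply: ler_sum => i _.
  rewrite (le_trans (ler_wpM2r (normc_ge0 y) (normc_sum _ _ _)))//.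
  rewrite !mulr_suml; apply: ler_sum => j _.
  have rhs0 : 0 <= normc (f`_i`_j)%:C * X ^+ i * normc y ^+ d.
    by rewrite !mulr_ge0 ?normc_ge0 ?exprn_ge0 ?normc_ge0// (le_trans _ xX)// normc_ge0.
  rewrite /G; case: ifPn => [_|ij].
    by rewrite ComplexField.Normc.normc0 mul0r.
  have [fij|/leq_tdegree ijd] := eqVneq f`_i`_j 0.
    by rewrite fij rmorph0 !mul0r ComplexField.Normc.normc0 !mul0r.
  rewrite !ComplexField.Normc.normcM !normcX -!mulrA -exprSr.
  rewrite ler_wpM2l ?normc_ge0// ler_pM ?exprn_ge0 ?normc_ge0//.
    by rewrite lerXn2r// nnegrE ?normc_ge0// (le_trans _ xX)// normc_ge0.
  apply: ler_weXn2l; first exact: ltW.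
  have jd : (j < d.+1)%N := ltn_ord j.
  move: ij; rewrite negb_and => /orP[i0|j0]; last by lia.
  by move: ijd; rewrite -/d; lia.
rewrite ler_pdivlMr// mulrC -(ler_pM2r (exprn_gt0 d y0)).
apply: le_trans GS; rewrite mulrAC -normcX -[normc e * _]ComplexField.Normc.normcM.
by move/eqP: E; rewrite addr_eq0 => /eqP ->; rewrite normcN lexx.
Qed.

(** An irreducible polynomial is not constant, so its total degree [d] is
  positive, and the coefficient of [y^d] makes [f(0, y)] nonconstant. *)
Lemma curve_nonempty g : irreducible2 g -> g`_0`_(tdegree g) != 0 ->
  exists y, curve g (0, y).
Proof.
set d := tdegree g => -[_ gU _] gd.
have d0 : (0 < d)%N.
  rewrite lt0n; apply: contraNneq gU => d0; rewrite d0 in gd.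
  have -> : g = (g`_0`_0)%:P%:P.
    have := size_tdegree g; rewrite -/d d0 => /size1_polyC gE.
    rewrite [LHS]gE; congr _%:P; apply: size1_polyC.
    by have := size_coef_tdegree g 0; rewrite -/d d0.
  by rewrite !poly_unitE !size_polyC !coefC /= polyC_eq0 gd /= size_polyC gd unitfE gd.
have : size (map_poly (real_complex R) g`_0) != 1.
  rewrite size_map_poly; apply/eqP => s1.
  by move/eqP: gd; apply; rewrite nth_default// s1.
move=> /closed_rootP[y /rootP gy]; exists y.
by rewrite /curve/= polyC0 horner_coef0 coef_map.
Qed.

Lemma bounded_distance f g : irreducible2 g ->
    f`_0`_(tdegree f) != 0 -> g`_0`_(tdegree g) != 0 ->
    (forall B : infinity_branch f, exists B' : infinity_branch g,
       convergent_branches B B') ->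
  exists C, forall p, curve f p -> exists2 q, curve g q & edist2 p q <= C.
Proof.
move=> girr fd gd asym.
have [X [C far]] := far_points fd asym.
have [D near_] := near_points_bounded X fd.
have [y0 gy0] := curve_nonempty girr gd.
have dist (p q : R[i] * R[i]) a b : normc (p.1 - q.1) <= a ->
    normc (p.2 - q.2) <= b -> edist2 p q <= a + b.
  move=> pa pb.
  have a0 : 0 <= a := le_trans (normc_ge0 _) pa.
  have b0 : 0 <= b := le_trans (normc_ge0 _) pb.
  rewrite /edist2 -[leRHS]ger0_norm ?addr_ge0// -sqrtr_sqr ler_sqrt ?sqr_ge0//.
  rewrite sqrrD addrAC ler_wpDr ?mulrn_wge0 ?mulr_ge0// lerD// lerXn2r//;
  by rewrite nnegrE ?normc_ge0.
exists (Num.max (0 + C) (X + (D + normc y0))) => -[x y] fxy.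
have [Xx|xX] := ltP X (normc x).
  have [y' gy' le] := far x y Xx fxy; exists (x, y') => //.
  rewrite le_max dist//= subrr ComplexField.Normc.normc0 //.
exists (0, y0) => //; rewrite le_max orbC dist//= ?subr0//.
rewrite (le_trans (normcD _ _))// normcN lerD//; exact: near_ fxy.
Qed.

Lemma ereal_sup_dist_set (A B : set (R[i] * R[i])) (C : R) : A !=set0 ->
    (forall p, A p -> exists2 q, B q & edist2 p q <= C) ->
  (0 <= ereal_sup [set dist_set p B | p in A] <= C%:E)%E.
Proof.
move=> [p0 Ap0] AB; apply/andP; split.
  apply: le_ereal_sup_tmp; exists (dist_set p0 B); first by exists p0.
  by apply: le_ereal_inf_tmp => _ [q _ <-]; rewrite lee_fin sqrtr_ge0.
apply: ge_ereal_sup => _ [p Ap <-]; have [q Bq le] := AB p Ap.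
by apply: ge_ereal_inf; exists (edist2 p q)%:E; [exists q|rewrite lee_fin].
Qed.

End Hausdorff.

Theorem proposition5p4 (R : realType) (f g : {poly {poly R}})
  (f_irr : irreducible2 f) (g_irr : irreducible2 g)
  (f_inf : ~ infinity_point f 0 1) (g_inf : ~ infinity_point g 0 1)
  (fg_asym : same_asymptotic_behavior f g) :
  hausdorff_dist (curve f) (curve g) \is a fin_num.
Proof.
have fd : f`_0`_(tdegree f) != 0 by apply/eqP => /infinity_point01.
have gd : g`_0`_(tdegree g) != 0 by apply/eqP => /infinity_point01.
have [C fC] := bounded_distance g_irr fd gd fg_asym.1.
have [D gD] := bounded_distance f_irr gd fd fg_asym.2.
have [y fy] := curve_nonempty f_irr fd; have [y' gy'] := curve_nonempty g_irr gd.
have /andP[f0 fle] := ereal_sup_dist_set (ex_intro _ (0, y) fy) fC.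
have /andP[g0 gle] := ereal_sup_dist_set (ex_intro _ (0, y') gy') gD.
rewrite ge0_fin_numE ?le_max ?f0// gt_max.
by rewrite (le_lt_trans fle) ?ltry// (le_lt_trans gle) ?ltry.
Qed.
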